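(* For each integer $d\ge2$ there is a right-angled Coxeter group $G_d$ such that for each integer $m$ with $2\le m\le d$ the group $G_d$ contains a join-free subgroup $H_d^m$ which is isomorphic to the group $F=\langle a,b,c\mid a^2=b^2=c^2=e\rangle$ and whose subgroup divergence in $G_d$ is a polynomial of degree $m$.
   Context: Right-angled Coxeter group: for a finite simplicial graph $\Gamma$ with vertex set $S$, $G_\Gamma$ is generated by $S$ with relations $s^2=1$ for $s\in S$ and $st=ts$ for adjacent $s,t$. For an induced subgraph $\Lambda$, $G_\Lambda\le G_\Gamma$ is the subgroup generated by the vertices of $\Lambda$. The join of two non-empty graphs is obtained by connecting every vertex of one to every vertex of the other. A join subgroup is $G_J$ with $J$ an induced subgraph decomposing as a join. A subgroup $H\le G_\Gamma$ is join-free if it is infinite and none of its infinite order elements are conjugate into a join subgroup. Subgroup divergence. For a geodesic space $X$, subspace $A$ and $r>0$: $N_r(A)=\{x: d(x,A)<r\}$, $\partial N_r(A)=\{x: d(x,A)=r\}$, $C_r(A)=X-N_r(A)$, and $d_r$ is the induced length metric on $C_r(A)$ (value $\infty$ if there is no connecting path). For $\rho\in(0,1]$ and integer $n\ge2$ define $\sigma^n_\rho\colon[0,\infty)\to[0,\infty]$ by $\sigma^n_\rho(r)=\inf d_{\rho r}(x_1,x_2)$ over all $x_1,x_2\in\partial N_r(A)$ with $d_r(x_1,x_2)<\infty$ and $d(x_1,x_2)\ge nr$, and $\sigma^n_\rho(r)=\infty$ if there is no such pair. The subspace divergence of $A$ in $X$ is the family $\{\sigma^n_\rho\}$. The subgroup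 divergence of $H$ in a finitely generated group $G$ is the subspace divergence of $H$ in a Cayley graph of $G$ for a finite generating set (up to the equivalence below it does not depend on this choice). For functions $f,g\colon[0,\infty)\to[0,\infty]$, $f\preceq g$ means there are positive constants $A,B,C,D$ with $f(x)\le Ag(Bx)+Cx$ for all $x>D$. For families, $\{\delta^n_\rho\}\preceq\{\delta'^n_\rho\}$ means there are $L\in(0,1]$ and a positive integer $M$ with $\delta^n_{L\rho}\preceq\delta'^{Mn}_\rho$ for all $\rho,n$. Equivalence $\sim$ means $\preceq$ in both directions. A function $f$ is regarded as the constant family $\delta^n_\rho=f$. The subgroup divergence is a polynomial of degree $m$ if the family is equivalent to a polynomial of degree $m$. *)

(* Defs.v *)
From HB Require Import structures.
From mathcomp Require Import all_boot all_order all_algebra.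
From mathcomp Require Import generic_quotient.
From mathcomp Require Import mathcomp_extra boolp classical_sets functions.
From mathcomp Require Import cardinality set_interval reals ereal topology.
From mathcomp Require Import normedtype numfun.

Set Implicit Arguments.
Unset Strict Implicit.
Unset Printing Implicit Defensive.

Import Order.TTheory GRing.Theory Num.Theory.
Import numFieldTopology.Exports.

Local Open Scope classical_set_scope.
Local Open Scope ring_scope.
Local Open Scope quotient_scope.

(* A letter is [(s, true)] for a generator [s] and [(s, false)] for [s^-1]. *)
Definition word (S : Type) := seq (S * bool).

Definition gen (S : Type) (s : S) : S * bool := (s, true).

Definition inv_word (S : Type) (w : word S) : word S :=
  rev [seq (l.1, ~~ l.2) | l <- w].

(* [rels u v] means that [u = v] is one of the defining relations. *)
Inductive word_eq (S : Type) (rels : word S -> word S -> Prop) :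
  word S -> word S -> Prop :=
| word_eq_refl u : word_eq rels u u
| word_eq_sym u v : word_eq rels u v -> word_eq rels v u
| word_eq_trans v u w : word_eq rels u v -> word_eq rels v w ->
    word_eq rels u w
| word_eq_cat u u' v v' : word_eq rels u u' -> word_eq rels v v' ->
    word_eq rels (u ++ v) (u' ++ v')
| word_eq_cancel s b : word_eq rels [:: (s, b); (s, ~~ b)] [::]
| word_eq_rel u v : rels u v -> word_eq rels u v.

Section PresentedGroup.
Variables (S : choiceType) (rels : word S -> word S -> Prop).

Definition word_eqb (u v : word S) : bool := `[< word_eq rels u v >].

Fact word_eqb_refl : reflexive word_eqb.
Proof. by move=> u; apply/asboolP; exact: word_eq_refl. Qed.

Fact word_eqb_sym : symmetric word_eqb.
Proof. by move=> u v; apply/asboolP/asboolP; exact: word_eq_sym. Qed.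

Fact word_eqb_trans : transitive word_eqb.
Proof.
by move=> v u w /asboolP uv /asboolP vw; apply/asboolP; exact: word_eq_trans vw.
Qed.

Canonical word_equiv := EquivRel word_eqb word_eqb_refl word_eqb_sym
  word_eqb_trans.

Definition presented := {eq_quot word_equiv}.

HB.instance Definition _ := Choice.on presented.
HB.instance Definition _ := Quotient.on presented.
HB.instance Definition _ := EqQuotient.on presented.

Definition class_of (w : word S) : presented := \pi_presented w.

Definition presented_one : presented := class_of [::].
Definition presented_mul (x y : presented) : presented :=
  class_of (repr x ++ repr y).
Definition presented_inv (x : presented) : presented :=
  class_of (inv_word (repr x)).

Lemma class_ofP u v : class_of u = class_of v <-> word_eq rels u v.
Proof.
split=> [/eqP|uv]; first by rewrite /class_of eqmodE => /asboolP.
by apply/eqP; rewrite /class_of eqmodE; apply/asboolP.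
Qed.

Lemma repr_class_of u : word_eq rels (repr (class_of u)) u.
Proof. by apply/class_ofP; rewrite /class_of reprK. Qed.

Lemma class_of_repr (x : presented) : class_of (repr x) = x.
Proof. by rewrite /class_of reprK. Qed.

Lemma presented_mulE u v :
  presented_mul (class_of u) (class_of v) = class_of (u ++ v).
Proof. by apply/class_ofP/word_eq_cat; exact: repr_class_of. Qed.

Lemma word_eq_mulVw w : word_eq rels (inv_word w ++ w) [::].
Proof.
elim: w => [|[s b] w IH]; first exact: word_eq_refl.
rewrite /inv_word /= rev_cons -cats1 -catA.
apply: word_eq_trans IH; apply: word_eq_cat; first exact: word_eq_refl.
apply: (@word_eq_cat _ _ [:: (s, ~~ b); (s, b)] [::] w w);
  last exact: word_eq_refl.
by rewrite -{2}(negbK b); exact: word_eq_cancel.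
Qed.

Lemma inv_wordK : involutive (@inv_word S).
Proof.
move=> w; rewrite /inv_word map_rev revK -map_comp -[RHS]map_id.
by apply: eq_map => -[s b] /=; rewrite negbK.
Qed.

Lemma word_eq_mulwV w : word_eq rels (w ++ inv_word w) [::].
Proof. by rewrite -{1}(inv_wordK w); exact: word_eq_mulVw. Qed.

Lemma presented_ind (P : presented -> Prop) :
  (forall w, P (class_of w)) -> forall x, P x.
Proof. by move=> Pw x; rewrite -(class_of_repr x). Qed.

Fact presented_mulA : associative presented_mul.
Proof.
elim/presented_ind=> u; elim/presented_ind=> v; elim/presented_ind=> w.
by rewrite !presented_mulE catA.
Qed.

Fact presented_mul1g : left_id presented_one presented_mul.
Proof. by elim/presented_ind=> u; rewrite presented_mulE. Qed.

Fact presented_mulg1 : right_id presented_one presented_mul.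
Proof. by elim/presented_ind=> u; rewrite presented_mulE cats0. Qed.

Fact presented_mulVg : left_inverse presented_one presented_inv presented_mul.
Proof.
move=> x; rewrite -{2}(class_of_repr x) presented_mulE.
by apply/class_ofP; exact: word_eq_mulVw.
Qed.

Fact presented_mulgV : right_inverse presented_one presented_inv presented_mul.
Proof.
move=> x; rewrite -{1}(class_of_repr x) presented_mulE.
by apply/class_ofP; exact: word_eq_mulwV.
Qed.

HB.instance Definition _ := isGroup.Build presented presented_mulA
  presented_mul1g presented_mulg1 presented_mulVg presented_mulgV.

End PresentedGroup.

Definition is_subgroup (G : groupType) (H : set G) : Prop :=
  [/\ H 1%g, forall x y, H x -> H y -> H (x * y)%g & forall x, H x -> H x^-1%g].

Definition generated (G : groupType) (A : set G) : set G :=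
  smallest (@is_subgroup G) A.

Definition generates (G : groupType) (T : set G) : Prop := generated T = setT.

Definition infinite_order (G : groupType) (x : G) : Prop :=
  forall n, (0 < n)%N -> (x ^+ n)%g <> 1%g.

Definition subgroup_isomorphic (F G : groupType) (H : set G) : Prop :=
  exists f : {multiplicative F -> G}, injective f /\ range f = H.

Inductive racg_rel (S : Type) (adj : rel S) : word S -> word S -> Prop :=
| racg_rel_sq s : racg_rel adj [:: gen s; gen s] [::]
| racg_rel_comm s t : adj s t ->
    racg_rel adj [:: gen s; gen t] [:: gen t; gen s].

Definition racg (S : finType) (adj : rel S) : groupType :=
  presented (racg_rel adj).

Definition racg_gen (S : finType) (adj : rel S) (s : S) : racg adj :=
  class_of (racg_rel adj) [:: gen s].

Definition special_subgroup (S : finType) (adj : rel S) (J : {set S}) :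
  set (racg adj) := generated [set racg_gen adj s | s in [set` J]].

(* The subgraph induced on [J] decomposes as a join. *)
Definition is_join (S : finType) (adj : rel S) (J : {set S}) : Prop :=
  exists A B : {set S}, [/\ A != finset.set0, B != finset.set0,
    (A :&: B = finset.set0)%SET, (A :|: B = J)%SET &
    forall a b, a \in A -> b \in B -> adj a b].

Definition join_free (S : finType) (adj : rel S) (H : set (racg adj)) : Prop :=
  infinite_set H /\
  forall x, H x -> infinite_order x ->
    ~ exists (g : racg adj) (J : {set S}),
        is_join adj J /\ special_subgroup J (x ^ g)%g.

Inductive F_rel : word 'I_3 -> word 'I_3 -> Prop :=
| F_rel_sq i : F_rel [:: gen i; gen i] [::].

Definition group_F : groupType := presented F_rel.

Inductive walk (V : Type) (adj : V -> V -> Prop) : V -> V -> Prop :=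
| walk_nil u : walk adj u u
| walk_cons u v w : adj u v -> walk adj v w -> walk adj u w.

Record cgraph := CGraph {
  vertex :> choiceType;
  adjacent : vertex -> vertex -> Prop;
  adjacent_sym : forall u v, adjacent u v -> adjacent v u;
  adjacent_irr : forall u, ~ adjacent u u;
  cgraph_connected : forall u v, walk adjacent u v }.

Section Realization.
Variables (R : realType) (V : cgraph).

(* [x] is, in barycentric coordinates, the point at distance [t] from [u] on
   the edge [uv]; it is the vertex [u] when [u = v]. *)
Definition on_segment (u v : V) (x : V -> R) : Prop :=
  (u = v \/ adjacent u v) /\
  exists t : R, [/\ 0 <= t, t <= 1 &
    x = fun w => (1 - t) * (w == u)%:R + t * (w == v)%:R].

Record realization := Realization {
  bary :> V -> R;
  _ : exists u v, on_segment u v bary }.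

Fact vtx_subproof (v : V) :
  exists u u', on_segment u u' (fun w => (w == v)%:R : R).
Proof.
exists v, v; split; first by left.
exists 0; split=> //.
by apply/funext => w; rewrite subr0 mul1r mul0r addr0.
Qed.

Definition vtx (v : V) : realization := Realization (vtx_subproof v).

(* [string x y l]: there is a chain from [x] to [y] of total length [l] with
   consecutive points on a common edge; edges have length 1. *)
Inductive string : realization -> realization -> R -> Prop :=
| string_nil x : string x x 0
| string_cons u v (x y z : realization) l : on_segment u v x -> on_segment u v y ->
    string y z l -> string x z (`|x u - y u| + l).

Definition rdist (x y : realization) : R := inf [set l | string x y l].

HB.instance Definition _ := gen_eqMixin realization.
HB.instance Definition _ := gen_choiceMixin realization.

Lemma bary_inj (x y : realization) : bary x = bary y -> x = y.
Proof.
case: x y => [x xP] [y yP] /= xy; rewrite xy in xP *.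
by congr Realization; exact: Prop_irrelevance.
Qed.

Lemma on_segment_sym u v (x : V -> R) : on_segment u v x -> on_segment v u x.
Proof.
move=> [uv [t [t0 t1 ->]]]; split.
  by case: uv => [->|/adjacent_sym uv]; [left|right].
exists (1 - t); split; rewrite ?subr_ge0 ?lerBlDr ?lerDl//.
by apply/funext => w; rewrite addrC opprB addrCA subrr addr0.
Qed.

(* Along a common edge all barycentric coordinates are 1-Lipschitz. *)
Lemma on_segment_lip u v w (x y : V -> R) :
  on_segment u v x -> on_segment u v y ->
  `|x w - y w| <= `|x u - y u|.
Proof.
move=> [_ [t [_ _ ->]]] [_ [s [_ _ ->]]].
have [<- | uv] := eqVneq u v.
  by rewrite -!mulrDl !subrK subrr normr0 normr_ge0.
rewrite eqxx !mulr1 !mulr0 !addr0.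
have [-> | _] := eqVneq w u; first by rewrite (negPf uv) !mulr1 !mulr0 !addr0.
have [_ | _] := eqVneq w v; last by rewrite !mulr0 addr0 subrr normr0.
rewrite !mulr0 !mulr1 !add0r opprB [1 - t + _]addrC addrA subrK.
by rewrite distrC.
Qed.

Lemma string_ge x y l w : string x y l -> `|x w - y w| <= l.
Proof.
elim=> [z|u v {}x {}y z {}l xuv yuv _ IH]; first by rewrite subrr normr0.
rewrite (le_trans (ler_distD (y w) _ _))// lerD//.
exact: on_segment_lip xuv yuv.
Qed.

Lemma string_ge0 x y l : string x y l -> 0 <= l.
Proof. by elim=> // u v {}x {}y z {}l _ _ _ IH; rewrite addr_ge0. Qed.

Lemma string_cat y x z k l : string x y k -> string y z l -> string x z (k + l).
Proof.
elim=> [{}x|u v {}x {}y w {}k xuv yuv _ IH] sl; first by rewrite add0r.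
by rewrite -addrA; apply: (string_cons xuv yuv); exact: IH.
Qed.

Lemma string_rev x y l : string x y l -> string y x l.
Proof.
elim=> [{}x|u v {}x {}y z {}l xuv yuv _ IH]; first exact: string_nil.
rewrite addrC; apply: (string_cat IH); rewrite distrC -[X in string _ _ X]addr0.
exact: string_cons yuv xuv (string_nil x).
Qed.

Lemma on_segment_vtx u v : u = v \/ adjacent u v -> on_segment u v (vtx u).
Proof.
move=> uv; split=> //; exists 0; split=> //.
by apply/funext => w; rewrite /= subr0 mul1r mul0r addr0.
Qed.

Lemma string_exists x y : exists l, string x y l.
Proof.
have toV z : exists v l, string z (vtx v) l.
  have [u [v zuv]] : exists u v, on_segment u v z by case: z.
  exists u, (`|z u - vtx u u| + 0).
  have uuv : on_segment u v (vtx u) by apply: on_segment_vtx; case: zuv.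
  exact: string_cons zuv uuv (string_nil _).
have [u [k xu]] := toV x; have [v [l yv]] := toV y.
suff [m uv] : exists m, string (vtx u) (vtx v) m.
  by exists (k + (m + l)); apply/(string_cat xu)/(string_cat uv)/string_rev.
elim: (cgraph_connected u v) => [u1|u1 w v1 uw _ [m wv]].
  by exists 0; exact: string_nil.
exists (`|vtx u1 u1 - vtx w u1| + m); apply: (@string_cons u1 w) wv.
  by apply: on_segment_vtx; right.
by apply: on_segment_sym; apply: on_segment_vtx; right; exact: adjacent_sym.
Qed.

Lemma rdist_le x y l : string x y l -> rdist x y <= l.
Proof.
move=> sl; apply: ge_inf => //.
by exists 0 => k /string_ge0.
Qed.

Lemma le_rdist x y a : (forall l, string x y l -> a <= l) -> a <= rdist x y.
Proof.
by move=> al; apply: lb_le_inf; [exact: string_exists|move=> l /al].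
Qed.

Fact rdistxx x : rdist x x = 0.
Proof.
apply/eqP; rewrite eq_le rdist_le/=; last exact: string_nil.
by apply: le_rdist => l /string_ge0.
Qed.

Fact rdist_positivity x y : rdist x y = 0 -> x = y.
Proof.
move=> xy0; apply: bary_inj; apply/funext => w; apply/eqP.
rewrite -subr_eq0 -normr_le0 -xy0; apply: le_rdist => l.
exact: string_ge.
Qed.

Fact rdist_sym x y : rdist x y = rdist y x.
Proof.
by apply/eqP; rewrite eq_le; apply/andP; split;
  apply: le_rdist => l /string_rev; exact: rdist_le.
Qed.

Fact rdist_triangle y x z : rdist x z <= rdist x y + rdist y z.
Proof.
rewrite -lerBlDr; apply: le_rdist => k xy.
rewrite lerBlDr addrC -lerBlDr; apply: le_rdist => l yz.
by rewrite lerBlDr addrC; apply: rdist_le; exact: string_cat yz.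
Qed.

HB.instance Definition _ := isMetric.Build R realization
  rdistxx rdist_positivity rdist_sym rdist_triangle.

End Realization.

Section Cayley.
Variables (G : groupType) (T : set G) (genT : generates T).

(* Simplicial Cayley graph: no loops, no multiple edges. *)
Definition cayley_adj (x y : G) : Prop :=
  x <> y /\ exists2 s, T s & y = (x * s)%g \/ x = (y * s)%g.

Fact cayley_adj_sym x y : cayley_adj x y -> cayley_adj y x.
Proof.
move=> [xy [s Ts yx]]; split; first by move/esym.
by exists s => //; case: yx; [right|left].
Qed.

Fact cayley_adj_irr x : ~ cayley_adj x x.
Proof. by case. Qed.

Fact cayley_connected x y : walk cayley_adj x y.
Proof.
have walk_trans a b c : walk cayley_adj a b -> walk cayley_adj b c ->
    walk cayley_adj a c.
  by elim=> // u v w uv _ IH /IH; exact: walk_cons.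
have walk_sym a b : walk cayley_adj a b -> walk cayley_adj b a.
  elim=> [u|u v w uv _ IH]; first exact: walk_nil.
  apply: (walk_trans _ _ _ IH); apply: walk_cons (walk_nil _ _).
  exact: cayley_adj_sym.
have walk_mul a b c : walk cayley_adj a b -> walk cayley_adj (c * a)%g (c * b)%g.
  elim=> [u|u v w [uv [s Ts us]] _ IH]; first exact: walk_nil.
  apply: walk_cons IH; split; first by move/mulgI.
  by exists s => //; case: us => ->; rewrite mulgA; [left|right].
pose K : set G := [set g | walk cayley_adj 1%g g].
have gK : generated T `<=` K.
  apply: smallest_sub; last first.
    move=> s Ts; rewrite /K /=; have [<-|s1] := pselect (1%g = s).
      exact: walk_nil.
    apply: walk_cons (walk_nil _ _); split=> //.
    by exists s => //; left; rewrite mul1g.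
  split; first exact: walk_nil.
    move=> a b Ka Kb; apply: (walk_trans _ a) => //.
    by rewrite -{1}(mulg1 a); exact: walk_mul.
  by move=> a /(walk_mul _ _ a^-1%g); rewrite mulg1 mulVg; exact: walk_sym.
have : K (x^-1 * y)%g by apply: gK; rewrite genT.
by move=> /(walk_mul _ _ x); rewrite mulg1 mulVKg.
Qed.

Definition cayley : cgraph :=
  CGraph cayley_adj_sym cayley_adj_irr cayley_connected.

End Cayley.

Section Divergence.
Variables (R : realType) (X : metricType R).
Implicit Types (A C : set X) (x y : X) (r rho : R) (n : nat).

Definition curve_length (c : R -> X) : \bar R :=
  ereal_sup [set (\sum_(0 <= i < size s)
                    mdist (c (nth 1 (0 :: s) i)) (c (nth 1 (0 :: s) i.+1)))%:E
            | s in itv_partition 0 1].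

Definition curve_in C x y (c : R -> X) : Prop :=
  [/\ {within `[0, 1], continuous c}, c 0 = x, c 1 = y &
      forall t, 0 <= t <= 1 -> C (c t)].

(* The length metric of the subspace [C]: [+oo] when no curve in [C] joins [x]
   to [y] or none of them is rectifiable, as [ereal_inf set0 = +oo]. *)
Definition length_dist C x y : \bar R :=
  ereal_inf [set curve_length c | c in curve_in C x y].

(* On a metric space [edist] is [mdist], so [edist_inf A x] is d(x, A). *)
Definition nbhd r A : set X := [set x | (edist_inf A x < r%:E)%E].

Definition bd_nbhd r A : set X := [set x | edist_inf A x = r%:E].

Definition co_nbhd r A : set X := ~` nbhd r A.

Definition divergence A n rho r : \bar R :=
  ereal_inf [set l | exists x1 x2,
    [/\ bd_nbhd r A x1 /\ bd_nbhd r A x2,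
        (length_dist (co_nbhd r A) x1 x2 < +oo)%E,
        n%:R * r <= mdist x1 x2 &
        l = length_dist (co_nbhd (rho * r) A) x1 x2]].

End Divergence.

(* Functions [0, +oo) -> [0, +oo]; values at negative arguments are junk. *)
Definition preceq (R : realType) (f g : R -> \bar R) : Prop :=
  exists a b c d : R, [/\ 0 < a, 0 < b, 0 < c, 0 < d &
    forall x, d < x -> (f x <= a%:E * g (b * x)%R + (c * x)%:E)%E].

(* A family is indexed by [n >= 2] and [rho] in (0, 1]; its other members are
   junk. *)
Definition fam_preceq (R : realType) (f g : nat -> R -> R -> \bar R) : Prop :=
  exists (L : R) (M : nat), [/\ 0 < L, L <= 1, (0 < M)%N &
    forall rho n, 0 < rho -> rho <= 1 -> (2 <= n)%N ->
      preceq (f n (L * rho)) (g (M * n)%N rho)].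

Definition fam_equiv (R : realType) (f g : nat -> R -> R -> \bar R) : Prop :=
  fam_preceq f g /\ fam_preceq g f.

Definition polynomial_of_degree (R : realType) (m : nat)
    (f : nat -> R -> R -> \bar R) : Prop :=
  exists p : {poly R}, [/\ size p = m.+1, forall x, 0 <= x -> 0 <= p.[x] &
    fam_equiv f (fun _ _ x => p.[x]%:E)].

Definition subgroup_divergence (R : realType) (G : groupType) (T : set G)
    (genT : generates T) (H : set G) : nat -> R -> R -> \bar R :=
  divergence [set vtx R (h : cayley genT) | h in H].

(* Up to [fam_equiv] the divergence does not depend on the finite generating
   set; the property is required of all of them. *)
Definition subgroup_divergence_degree (R : realType) (G : groupType)
    (H : set G) (m : nat) : Prop :=
  forall (T : set G) (genT : generates T), finite_set T ->
    polynomial_of_degree m (@subgroup_divergence R G T genT H).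

(* In particular [subgroup_divergence_degree] is not void for these groups. *)
Lemma racg_finitely_generated (S : finType) (adj : rel S) :
  finite_set (range (racg_gen adj)) /\ generates (range (racg_gen adj)).
Proof.
split; first exact: finite_image.
apply/seteqP; split=> // x _ K [[K1 KM KV] genK].
elim/presented_ind: x => w; elim: w => [//|[s b] w IH].
have -> : class_of (racg_rel adj) ((s, b) :: w) =
    (racg_gen adj s * class_of (racg_rel adj) w)%g.
  rewrite [RHS]presented_mulE; apply/class_ofP.
  rewrite -cat1s; apply: word_eq_cat (word_eq_refl _ _).
  case: b => /=; first exact: word_eq_refl.
  rewrite -[X in word_eq _ X]cats0.
  apply: (@word_eq_trans _ _ ([:: (s, false)] ++ [:: gen s; gen s])).
    apply: word_eq_cat (word_eq_refl _ _) (word_eq_sym (word_eq_rel _)).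
    exact: racg_rel_sq.
  apply: (@word_eq_cat _ _ [:: (s, false); gen s] [::] [:: gen s]).
    exact: (word_eq_cancel _ s false).
  exact: word_eq_refl.
by apply: KM => //; apply: genK; exists s.
Qed.

(* Main.v *)
(* In a right-angled Coxeter group G, let a, b, c be pairwise non-adjacent vertices
   without common neighbours; H = <a, b, c> is a copy of F and is join-free. A path
   outside the r-neighbourhood of H whose ends are far apart along H crosses linearly
   many walls dual to edges of H, and between two of these walls with labels s and t
   it joins a point of the coset of the subgroup of the star of s to one of the star
   of t. If s and t have at most one common neighbour, that portion crosses linearly
   many walls labelled by neighbours of s, and the argument can be repeated. The
   defining graph is a union of pieces of binary trees, graded by height, where the
   argument can be repeated exactly as often as the height of the labels allows: at
   height 1 all vertices have the same two neighbours, which generate an infinite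
   dihedral group along which one moves between the walls for free. So three vertices
   of height m with different parents give divergence of degree m: following
   alternating words in the children gives detours of length O(r^m).

   For another finite generating set, both bounds are transferred between words and
   curves in its Cayley graph, where distances change by a bounded factor. *)

Require Import Defs.
From HB Require Import structures.
From mathcomp Require Import all_boot all_order all_algebra.
From mathcomp Require Import generic_quotient.
From mathcomp Require Import mathcomp_extra boolp classical_sets functions.
From mathcomp Require Import cardinality set_interval reals ereal topology.
From mathcomp Require Import normedtype numfun.
From mathcomp Require Import zify ring lra.

Set Implicit Arguments.
Unset Strict Implicit.
Unset Printing Implicit Defensive.

Import Order.TTheory.
Local Open Scope classical_set_scope.

(** * Words and reduced forms *)

Section Words.
Variables (S : finType) (adj : rel S).
Local Notation G := (racg adj).
Implicit Types (u v w e : seq S) (g h x y : G) (s t p : S) (E K : pred S).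

(** That two words differ is always shown through [foldl_inv]: letters acting by involutions, with
    adjacent letters commuting, act through the group. This one principle gives retractions onto
    special subgroups ([elt_filter]), normal forms in the free product spanned by an independent set
    ([nf]) and crossing parities of walls ([parity]). Both bounds follow the same recursion, a
    linear number of steps each at the price of the level below. For the lower bound the radius is
    halved at every stage, because the base point moves to a wall that must itself stay far from the
    path. The obstacle there is that consecutive crossings may belong to walls with equal labels, to
    which the induction does not apply; a wall with another label then lies between them. For the
    upper bound a vertex commutes with the ray spelled by its two children, so one moves along the
    subgroup at no cost once the rays of different vertices are joined, which is the same problem
    one level lower. Starting from labels of level [m], [m - 1] stages are available, and the walls
    of the subgroup itself add one more factor, whence degree [m]. *)

Definition elt w : G := class_of (racg_rel adj) [seq gen s | s <- w].

Lemma elt_nil : elt [::] = 1%g. Proof. by []. Qed.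

Lemma elt_cat u v : elt (u ++ v) = (elt u * elt v)%g.
Proof. by rewrite /elt map_cat -presented_mulE. Qed.

Lemma elt_cons s w : elt (s :: w) = (elt [:: s] * elt w)%g.
Proof. by rewrite -cat1s elt_cat. Qed.

Lemma elt_rcons w s : elt (rcons w s) = (elt w * elt [:: s])%g.
Proof. by rewrite -cats1 elt_cat. Qed.

Lemma elt_sq s : (elt [:: s] * elt [:: s])%g = 1%g.
Proof.
rewrite -elt_cat; apply/class_ofP; apply: word_eq_rel; exact: racg_rel_sq.
Qed.

Lemma elt_comm s t : adj s t -> (elt [:: s] * elt [:: t] = elt [:: t] * elt [:: s])%g.
Proof.
move=> st; rewrite -!elt_cat; apply/class_ofP; apply: word_eq_rel.
exact: racg_rel_comm.
Qed.

Lemma elt_genV s : ((elt [:: s])^-1 = elt [:: s])%g.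
Proof. by apply: (mulgI (elt [:: s])); rewrite mulgV elt_sq. Qed.

Lemma elt_rev w : elt (rev w) = ((elt w)^-1)%g.
Proof.
elim: w => [|s w IH]; first by rewrite invg1.
by rewrite rev_cons elt_rcons IH (elt_cons s w) invgM elt_genV.
Qed.

Lemma word_eq_letter s b :
  word_eq (racg_rel adj) [:: (s, b)] [:: gen s].
Proof.
case: b; first exact: word_eq_refl.
rewrite -[X in word_eq _ X]cats0.
apply: (@word_eq_trans _ _ ([:: (s, false)] ++ [:: gen s; gen s])).
  apply: word_eq_cat (word_eq_refl _ _) (word_eq_sym (word_eq_rel _)).
  exact: racg_rel_sq.
apply: (@word_eq_cat _ _ [:: (s, false); gen s] [::] [:: gen s]).
  exact: (word_eq_cancel _ s false).
exact: word_eq_refl.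
Qed.

Lemma class_of_elt (w : word S) : class_of (racg_rel adj) w = elt [seq l.1 | l <- w].
Proof.
apply/class_ofP; elim: w => [|[s b] w IH] /=; first exact: word_eq_refl.
rewrite -cat1s -[X in word_eq _ _ X]cat1s.
by apply: word_eq_cat IH; exact: word_eq_letter.
Qed.

Lemma elt_surj g : exists w, elt w = g.
Proof. by elim/presented_ind: g => w; rewrite class_of_elt; eexists. Qed.

(** Every relator acts trivially on the set cut out by [P], so the right action of words factors
    through the group. *)
Lemma foldl_inv (X : Type) (P : X -> Prop) (a : X -> S -> X) :
  (forall z s, P z -> P (a z s)) ->
  (forall z s, P z -> a (a z s) s = z) ->
  (forall z s t, P z -> adj s t -> a (a z s) t = a (a z t) s) ->
  forall u v z, P z -> elt u = elt v -> foldl a z u = foldl a z v.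
Proof.
move=> Pa aa ac u v z Pz /class_ofP uv.
have fst_gen (w : seq S) : [seq l.1 | l <- [seq gen s | s <- w]] = w.
  by rewrite -map_comp map_id.
rewrite -[u]fst_gen -[v]fst_gen.
have Pf (w : seq S) z' : P z' -> P (foldl a z' w).
  by elim: w z' => //= s w IH z' Pz'; apply/IH/Pa.
elim: uv z Pz => {u v fst_gen} //=
  [u v _ IH|v u w _ IH1 _ IH2|u u' v v' _ IH1 _ IH2|s b|u v uv] z Pz.
- by rewrite IH.
- by rewrite IH1 ?IH2.
- by rewrite !map_cat !foldl_cat IH1 // IH2 //; exact: Pf.
- exact: aa.
- by case: uv => [s|s t st] /=; [exact: aa|exact: ac].
Qed.

Definition inspan K g := exists2 w, all K w & elt w = g.

Lemma inspan1 K : inspan K 1%g. Proof. by exists [::]. Qed.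
Lemma inspan_elt K w : all K w -> inspan K (elt w). Proof. by exists w. Qed.
Lemma inspanM K g h : inspan K g -> inspan K h -> inspan K (g * h)%g.
Proof.
by move=> [u Ku <-] [v Kv <-]; exists (u ++ v); rewrite ?all_cat ?Ku ?elt_cat.
Qed.
Lemma inspanV K g : inspan K g -> inspan K (g^-1)%g.
Proof. by move=> [u Ku <-]; exists (rev u); rewrite ?all_rev ?elt_rev. Qed.
Lemma inspan_sub K K' g : subpred K K' -> inspan K g -> inspan K' g.
Proof. by move=> KK' [u Ku <-]; exists u => //; exact: sub_all Ku. Qed.

Definition indep E := forall s t, E s -> E t -> ~~ adj s t.
Definition star p := [pred t | (t == p) || adj p t].
Definition link p := [pred t | adj p t].

(** Over an independent set the group is a free product of groups of order two, where these words
    are the normal forms. *)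
Definition reduced e := sorted (fun s t => s != t) e.

(* The normal form is stored in reverse order. *)
Definition push E e s :=
  if E s then if e is s' :: e' then if s' == s then e' else s :: e else [:: s]
  else e.

(** Letters outside [E] are skipped. For independent [E] this computes the retraction onto the
    subgroup spanned by [E], followed by reduction in a free product. *)
Definition nf E w := foldl (push E) [::] w.

Definition reducedin E e := reduced e && all E e.

Lemma push_reduced E e s : reducedin E e -> reducedin E (push E e s).
Proof.
rewrite /push /reducedin /reduced; case: ifP => // Es.
case: e => [|t e] /=; first by rewrite Es.
case/and3P=> pe Et Ee; case: (eqVneq t s) => [_|ts] /=; first by rewrite (path_sorted pe).
by rewrite eq_sym ts pe Es Et.
Qed.

Lemma foldl_push_reduced E e w : reducedin E e -> reducedin E (foldl (push E) e w).
Proof. by elim: w e => //= s w IH e re; apply/IH/push_reduced. Qed.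

Lemma nf_reduced E w : reducedin E (nf E w).
Proof. exact: foldl_push_reduced. Qed.

Lemma pushK E e s : reducedin E e -> push E (push E e s) s = e.
Proof.
rewrite /push /reducedin /reduced; case Es: (E s) => //.
case: e => [|t [|t' e]] /=; rewrite ?Es ?eqxx //; case: (eqVneq t s) => [->|ts] //=;
  rewrite ?Es ?eqxx //.
by case: (eqVneq t' s) => [->|]; rewrite ?eqxx.
Qed.

(** Of two adjacent letters at most one lies in [E], and the other one leaves the state
    unchanged. *)
Lemma push_comm E e s t : indep E -> adj s t ->
  push E (push E e s) t = push E (push E e t) s.
Proof.
move=> iE st; rewrite /push; case Es: (E s); case Et: (E t) => //.
by have := iE _ _ Es Et; rewrite st.
Qed.

Lemma foldl_push_eq E e u v : indep E -> reducedin E e -> elt u = elt v ->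
  foldl (push E) e u = foldl (push E) e v.
Proof.
move=> iE re uv.
apply: (@foldl_inv _ (reducedin E) (push E) _ _ _ u v e re uv).
- by move=> z s; exact: push_reduced.
- by move=> z s; exact: pushK.
- by move=> z s t _; exact: push_comm.
Qed.

Lemma nf_eq E u v : indep E -> elt u = elt v -> nf E u = nf E v.
Proof. by move=> iE; apply: foldl_push_eq. Qed.

Lemma foldl_push_out E e w : all (predC E) w -> foldl (push E) e w = e.
Proof.
elim: w e => //= s w IH e /andP[/negbTE Es /IH]; by rewrite /push Es.
Qed.

Lemma nf_cat_out E u w : all (predC E) u -> nf E (u ++ w) = nf E w.
Proof. by move=> Eu; rewrite /nf foldl_cat (foldl_push_out _ Eu). Qed.

Lemma nf_id E e : reducedin E e -> nf E e = rev e.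
Proof.
elim/last_ind: e => //= e s IH.
rewrite /reducedin all_rcons /reduced => /andP[se /andP[Es Ee]].
rewrite /nf foldl_rcons -/(nf E e) IH; last first.
  by rewrite /reducedin Ee andbT; case: e se {IH Ee} => //= a e; rewrite rcons_path => /andP[].
rewrite rev_rcons /push Es; case/lastP: e se {IH Ee} => //= e t.
rewrite rev_rcons; case: (eqVneq t s) => // <-.
case: e => /= [|a e]; first by rewrite eqxx.
by rewrite !rcons_path last_rcons eqxx !andbF.
Qed.

Lemma reduced_inj E e e' : indep E -> reducedin E e -> reducedin E e' ->
  elt e = elt e' -> e = e'.
Proof.
move=> iE re re' /(nf_eq iE); rewrite !nf_id // => /(congr1 rev).
by rewrite !revK.
Qed.

Lemma size_foldl_push E e w : size (foldl (push E) e w) <= size e + size w.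
Proof.
elim: w e => [|s w IH] e /=; first by rewrite addn0.
apply: leq_trans (IH _) _; rewrite addnS -addSn leq_add2r /push.
case: ifP => // _; case: e => //= t e; case: eqP => // _; exact: ltnW.
Qed.

Lemma size_nf E w : size (nf E w) <= size w.
Proof. exact: size_foldl_push. Qed.

Lemma nf_elt E w : all E w -> elt (rev (nf E w)) = elt w.
Proof.
elim/last_ind: w => //= w s IH; rewrite all_rcons => /andP[Es /IH {IH}].
rewrite /nf foldl_rcons -/(nf E w) elt_rcons => <-.
rewrite /push Es; case: (nf E w) => [|t e]; first by rewrite mul1g.
case: (eqVneq t s) => [->|ts]; last by rewrite rev_cons elt_rcons.
by rewrite rev_cons elt_rcons -mulgA elt_sq mulg1.
Qed.

Lemma reduced_rev e : reduced (rev e) = reduced e.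
Proof.
by rewrite /reduced rev_sorted; apply: eq_sorted => s t; rewrite eq_sym.
Qed.

Lemma inspanP E g : inspan E g -> exists2 e, reducedin E e & elt e = g.
Proof.
move=> [w Ew <-]; exists (rev (nf E w)); last exact: nf_elt.
have /andP[rw ew] := nf_reduced E w.
by rewrite /reducedin all_rev ew reduced_rev rw.
Qed.

Lemma reduced_take n e : reduced e -> reduced (take n e).
Proof. exact: take_sorted. Qed.
Lemma reduced_drop n e : reduced e -> reduced (drop n e).
Proof. exact: drop_sorted. Qed.

Lemma reducedin_take n E e : reducedin E e -> reducedin E (take n e).
Proof.
case/andP=> re Ee; apply/andP; split; first exact: reduced_take.
by rewrite -(cat_take_drop n e) all_cat in Ee; case/andP: Ee.
Qed.

Lemma inspan_take n E e : reducedin E e -> inspan E (elt (take n e)).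
Proof. by move=> /(reducedin_take n) /andP[_ Ee]; exact: inspan_elt. Qed.

(** Erasing the letters outside [K] sends each relator to a relator or to a trivial identity: this
    is the retraction onto the special subgroup of [K]. *)
Lemma elt_filter K u v : elt u = elt v -> elt (seq.filter K u) = elt (seq.filter K v).
Proof.
move=> uv; pose a g s := (g * (if K s then elt [:: s] else 1))%g.
have aE w g : foldl a g w = (g * elt (seq.filter K w))%g.
  elim: w g => [|s w IH] g /=; first by rewrite elt_nil mulg1.
  rewrite IH /a; case: ifP => _; last by rewrite mulg1.
  by rewrite [in RHS]elt_cons mulgA.
have := @foldl_inv _ (fun=> True) a _ _ _ u v 1%g I uv.
rewrite !aE !mul1g; apply=> // [g s _|g s t _ st]; rewrite /a.
  by case: ifP => _; rewrite -mulgA ?elt_sq ?mulg1.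
by case: ifP => _; case: ifP => _; rewrite ?mulg1 // -!mulgA elt_comm.
Qed.

Lemma inspan_filter K E w : inspan K (elt w) -> inspan (predI K E) (elt (seq.filter E w)).
Proof.
move=> [u Ku /(elt_filter E) <-]; exists (seq.filter E u) => //.
by rewrite all_filter; apply: sub_all Ku => s /= Ks; apply/implyP => Es; apply/andP.
Qed.

End Words.

(** * Walls *)

Section Walls.
Variables (S : finType) (adj : rel S).
Hypotheses (adj_sym : symmetric adj) (adj_irr : irreflexive adj).
Local Notation G := (racg adj).
Local Notation elt := (elt adj).
Local Notation star := (star adj).
Local Notation inspan := (@inspan _ adj).
Local Notation indep := (indep adj).
Implicit Types (u v w e : seq S) (g h x y : G) (s t p : S) (E K : pred S).

(* The wall dual to the edge (x, x s) contains the edges (g, g s) with x^-1 g in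
   the subgroup of the star of s. The parity of the number of its crossings by a
   path depends only on the endpoints of the path, because each relator crosses
   every wall an even number of times; this replaces the theory of hyperplanes. *)
Definition crosses x s g w i :=
  [/\ i < size w, nth s w i = s & inspan (star s) (x^-1 * (g * elt (take i w)))%g].

Definition cross_step x s (gb : G * bool) t :=
  ((gb.1 * elt [:: t])%g, gb.2 (+) ((t == s) && `[< inspan (star s) (x^-1 * gb.1)%g >])).

Definition parity x s g w := (foldl (cross_step x s) (g, false) w).2.

Lemma inspan_mulr K g t : K t -> inspan K (g * elt [:: t])%g <-> inspan K g.
Proof.
move=> Kt; have It : inspan K (elt [:: t]) by apply: inspan_elt; rewrite /= Kt.
split=> [gt|gt]; last exact: inspanM.
by rewrite -[g]mulg1 -(elt_sq adj t) mulgA; exact: inspanM.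
Qed.

Lemma inspan_mulrb K g t : K t -> `[< inspan K (g * elt [:: t])%g >] = `[< inspan K g >].
Proof. by move=> Kt; apply: asbool_equiv_eq; exact: inspan_mulr. Qed.

Lemma foldl_cross x s g b w :
  foldl (cross_step x s) (g, b) w = ((g * elt w)%g, b (+) parity x s g w).
Proof.
rewrite /parity; elim: w g b => [|t w IH] g b /=; first by rewrite mulg1 addbF.
rewrite /cross_step /= IH [in RHS]IH (elt_cons adj t w) mulgA /=.
by rewrite addbA.
Qed.

Lemma parity_cat x s g u v :
  parity x s g (u ++ v) = parity x s g u (+) parity x s (g * elt u)%g v.
Proof. by rewrite {1}/parity foldl_cat !foldl_cross. Qed.

Lemma parity1 x s g t :
  parity x s g [:: t] = (t == s) && `[< inspan (star s) (x^-1 * g)%g >].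
Proof. by []. Qed.

Lemma parity_eq x s g u v : elt u = elt v -> parity x s g u = parity x s g v.
Proof.
move=> uv; rewrite /parity; congr (_ .2).
apply: (@foldl_inv _ adj _ (fun=> True) (cross_step x s) _ _ _ u v (g, false) I uv) => //.
- move=> [h b] t _; rewrite /cross_step /= -mulgA elt_sq mulg1; congr (_, _).
  rewrite -addbA; case: (eqVneq t s) => [->|_] /=; last by rewrite addbF.
  by rewrite mulgA inspan_mulrb ?addbb ?addbF //= eqxx.
(* Opposite edges of a commutation square are dual to the same wall, since each of the two letters
   lies in the star of the other. *)
- move=> [h b] t t' _ tt'; rewrite /cross_step /= -!mulgA elt_comm //; congr (_, _).
  rewrite -!addbA; congr (_ (+) _); rewrite addbC.
  rewrite !mulgA; congr (_ (+) _).
    by case: (eqVneq t' s) => //= t's; rewrite inspan_mulrb //= -t's adj_sym tt' orbT.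
  by case: (eqVneq t s) => //= ts; rewrite inspan_mulrb //= -ts tt' orbT.
Qed.

Lemma parity_crosses x s g w : parity x s g w -> exists i, crosses x s g w i.
Proof.
elim/last_ind: w => //= w t IH; rewrite -cats1 parity_cat parity1.
case wp: (parity _ _ _ _).
  move=> _; have [i [iw si xi]] := IH wp; exists i; split.
  - by rewrite size_cat ltn_addr.
  - by rewrite nth_cat iw.
  - by rewrite takel_cat // ltnW.
case/andP => /eqP <- /asboolP gi; exists (size w); split.
- by rewrite size_cat addn1.
- by rewrite nth_cat ltnn subnn.
- by rewrite take_size_cat.
Qed.

Lemma parityN x s g w : (forall i, ~ crosses x s g w i) -> parity x s g w = false.
Proof. by move=> nc; apply/negP => /parity_crosses [i /nc]. Qed.

Lemma parity_notin x s g w : s \notin w -> parity x s g w = false.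
Proof.
move=> sw; apply: parityN => i [iw si _]; move/negP: sw; apply.
by rewrite -si mem_nth.
Qed.

Lemma parity_rev x s g w : parity x s (g * elt w)%g (rev w) = parity x s g w.
Proof.
have : parity x s g (w ++ rev w) = false.
  by rewrite (@parity_eq _ _ _ _ [::]) // elt_cat elt_rev mulgV.
by rewrite parity_cat; case: (parity _ _ _ w); case: (parity _ _ _ _).
Qed.

Lemma crosses_sub x s g w a n i :
  crosses x s (g * elt (take a w))%g (take n (drop a w)) i -> crosses x s g w (a + i).
Proof.
move=> [ik si xi].
have in_ : i < n by apply: leq_trans ik _; rewrite size_take_min geq_minl.
have iw : a + i < size w.
  by move: ik; rewrite size_take_min size_drop; lia.
split=> //; first by move: si; rewrite nth_take // nth_drop.
move: xi; rewrite -mulgA -elt_cat takeD.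
by rewrite take_takel // ltnW.
Qed.

(** The retraction onto [E] fixes [e] and maps the star subgroup of [s] into the group of order two
    generated by [s], because [s] has no neighbour in [E]. *)
Lemma star_indep E s e : indep E -> E s -> reducedin E e ->
  inspan (star s) (elt e) -> e = [::] \/ e = [:: s].
Proof.
move=> iE Es re /(inspan_filter E).
have Ee : seq.filter E e = e by apply/all_filterP; case/andP: re.
rewrite Ee => /(inspan_sub (K' := pred1 s)) [] //.
  move=> t /= /andP[/orP[//|st] Et]; by have := iE _ _ Es Et; rewrite st.
move=> w sw we.
have i1 : indep (pred1 s) by move=> a b /= /eqP -> /eqP ->; rewrite adj_irr.
have [f rf fw] : exists2 f, reducedin (pred1 s) f & elt f = elt w.
  by apply: inspanP; exists w.
have rf' : reducedin E f.
  case/andP: rf => rf sf; apply/andP; split=> //.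
  by apply: sub_all sf => a /= /eqP ->.
rewrite (reduced_inj iE re rf') ?fw //.
case/andP: rf; case: f {rf' fw} => [|a [|b f]] /=; first by left.
  by move=> _ /andP[/eqP -> _]; right.
by move=> /andP[ab _] /and3P[/eqP aE /eqP bE _]; rewrite aE bE eqxx in ab.
Qed.

End Walls.

(** * The walls met by a reduced word over an independent set *)

Section Chain.
Variables (S : finType) (adj : rel S).
Hypotheses (adj_sym : symmetric adj) (adj_irr : irreflexive adj).
Local Notation G := (racg adj).
Local Notation elt := (elt adj).
Local Notation star := (star adj).
Local Notation inspan := (@inspan _ adj).
Local Notation indep := (indep adj).
Implicit Types (u v w : seq S) (g h x : G) (s t p : S).

Variables (E : pred S) (e : seq S) (y : G) (s0 : S).
Hypotheses (iE : indep E) (re : reducedin E e).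

(** Starting point of edge [j] on the path that reads [e] from [y]; with letter [j] of [e] it names
    the wall dual to that edge. *)
Definition wall_at j := (y * elt (take j e))%g.
Definition wcross j g w i := crosses (wall_at j) (nth s0 e j) g w i.
Definition wpar j g w := parity (wall_at j) (nth s0 e j) g w.

Lemma reduced_neq i : i.+1 < size e -> nth s0 e i != nth s0 e i.+1.
Proof. by case/andP: re => /sortedP r _; exact: r. Qed.

Lemma chain_E i : i < size e -> E (nth s0 e i).
Proof. by move=> ie; case/andP: re => _ /all_nthP; exact. Qed.

Lemma wall_at_seg i j : i <= j -> (wall_at i * elt (drop i (take j e)) = wall_at j)%g.
Proof.
move=> ij; rewrite /wall_at -mulgA -elt_cat; congr (_ * elt _)%g.
by rewrite -{1}(take_takel e ij) cat_take_drop.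
Qed.

(** If both edges were dual to one wall, the part of [e] between them would lie in a star subgroup.
    By [star_indep] it would be a single letter, repeated at once in a reduced word. *)
Lemma wall_distinct i j g : i < j < size e -> nth s0 e i = nth s0 e j ->
  inspan (star (nth s0 e i)) ((wall_at i)^-1 * g)%g ->
  inspan (star (nth s0 e j)) ((wall_at j)^-1 * g)%g -> False.
Proof.
move=> /andP[ij jn] eij; rewrite -eij => gi /inspanV gj.
have := inspanM gi gj.
rewrite (invgM (wall_at j)^-1%g) invgK mulgA -(mulgA (wall_at i)^-1%g) mulgV mulg1.
rewrite -(wall_at_seg (ltnW ij)) mulKg => H.
have ie : i < size e by lia.
have rs : reducedin E (drop i (take j e)).
  case/andP: (reducedin_take j re) => r Er; apply/andP; split; first exact: reduced_drop.
  by rewrite -(cat_take_drop i (take j e)) all_cat in Er; case/andP: Er.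
have [|] := star_indep adj_irr iE (chain_E ie) rs H => /(congr1 size) /=;
  rewrite size_drop size_take jn; first lia.
move=> ji; have jE : j = i.+1 by lia.
by have := reduced_neq (i := i); rewrite -jE eij eqxx => /(_ jn).
Qed.

Lemma wcross_inj i j g w k : i < size e -> j < size e ->
  wcross i g w k -> wcross j g w k -> i = j.
Proof.
move=> ie je [kw ki gi] [_ kj gj].
have eij : nth s0 e i = nth s0 e j by rewrite -ki -kj; apply: set_nth_default.
case: (ltngtP i j) => // ij; exfalso.
  by apply: (wall_distinct (i := i) (j := j)) gi gj; rewrite ?ij.
by apply: (wall_distinct (i := j) (j := i)) gj gi; rewrite ?ij.
Qed.

(** By [wcross_inj] the word [e] crosses its wall [l] at step [l] only, so a stretch containing that
    step crosses it once. *)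
Lemma wpar_seg i j l : i <= l < j -> j <= size e ->
  wpar l (wall_at i) (drop i (take j e)).
Proof.
move=> /andP[il lj] je.
have le : l < size e by lia.
have nc k : wcross l y e k -> k = l.
  move=> lk; case: (lk) => ke ki _; apply: (@wcross_inj k l y e k) => //.
  split=> //; first by apply: set_nth_default.
  by rewrite mulVg; exact: inspan1.
have nc2 a b k : wcross l (wall_at a) (take b (drop a e)) k -> a + k = l.
  by move=> /crosses_sub /nc.
have -> : drop i (take j e) =
    drop i (take l e) ++ [:: nth s0 e l] ++ take (j - l.+1) (drop l.+1 e).
  have -> : take j e = take l e ++ [:: nth s0 e l] ++ take (j - l.+1) (drop l.+1 e).
    have {1}-> : j = l + (j - l) by lia.
    rewrite takeD; congr (_ ++ _); rewrite (drop_nth s0) //.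
    by have -> : j - l = (j - l.+1).+1 by lia.
  rewrite drop_cat size_take le; case: ltnP => // li.
  have -> : i = l by lia.
  by rewrite subnn drop0 [in RHS]drop_oversize ?size_take ?le.
rewrite /wpar parity_cat wall_at_seg // parity_cat parity1 eqxx mulVg /=.
have -> : `[< inspan (star (nth s0 e l)) 1%g >] by apply/asboolP; exact: inspan1.
have -> : (wall_at l * elt [:: nth s0 e l] = wall_at l.+1)%g.
  by rewrite /wall_at -mulgA -elt_rcons -take_nth.
rewrite -[in take l e](subnK il) -take_drop.
rewrite parityN => [|k kc]; last first.
  have := nc2 _ _ _ kc; case: kc => + _ _; rewrite size_take_min; lia.
rewrite parityN // => k kc.
have := nc2 _ _ _ kc; lia.
Qed.

Lemma parity_star l s : l != s -> E l -> E s -> forall x h u,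
  all (star s) u -> parity x l h u = false.
Proof.
move=> ls El Es x h u su; apply: parity_notin; apply/negP => /(allP su) /=.
by rewrite (negbTE ls) /= => sl; have := iE Es El; rewrite sl.
Qed.

Variables (g : G) (w : seq S) (F : nat).
Hypothesis F0 : 0 < F.
Hypothesis Hcost : forall i l a b, i < size e -> l < size e ->
  nth s0 e i != nth s0 e l -> a < b -> wcross i g w a -> wcross l g w b -> F <= b - a.

(* Two walls with the same label are separated by a wall with another label. *)
Lemma wcross_sep i j a b : i < size e -> j < size e -> i != j -> a <= b ->
  wcross i g w a -> wcross j g w b -> F <= b - a.
Proof.
move=> ie je ij ab ia jb.
have {}ab : a < b.
  rewrite ltn_neqAle ab andbT; apply/eqP => abE; rewrite -abE in jb.
  by move/eqP: ij; apply; apply: wcross_inj ia jb.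
case: (eqVneq (nth s0 e i) (nth s0 e j)) => [eij|]; last first.
  by move=> eij; apply: (Hcost ie je eij ab ia jb).
have [l [le [lb eil]]] : exists l, l < size e /\
    (i < l < j \/ j < l < i) /\ nth s0 e i != nth s0 e l.
  case: (ltngtP i j) ij => // ij _.
    have ni := reduced_neq (leq_ltn_trans ij je).
    exists i.+1; split; first lia; split=> //; left; rewrite ltnSn /= ltn_neqAle ij andbT.
    by apply/eqP => ijE; move: ni; rewrite eij ijE eqxx.
  have ni := reduced_neq (leq_ltn_trans ij ie).
  exists j.+1; split; first lia; rewrite eij; split=> //.
  right; rewrite ltnSn /= ltn_neqAle ij andbT.
  by apply/eqP => ijE; move: ni; rewrite -eij ijE eqxx.
(* Between the two crossings [w] has the endpoints of a word in the star of the common label, then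
   [D], then again a word in that star. Only [D] crosses the wall [l], so [w] must cross it in
   between. *)
pose D := if i < j then drop i (take j e) else rev (drop j (take i e)).
have DE : (wall_at i * elt D = wall_at j)%g.
  rewrite /D; case: ltnP => [/ltnW|] h; first exact: wall_at_seg.
  by rewrite -(wall_at_seg h) elt_rev mulgK.
have Dl : wpar l (wall_at i) D.
  case: lb => /andP[h1 h2].
    by rewrite /D (ltn_trans h1 h2); apply: wpar_seg; [rewrite h2 ltnW|exact: ltnW].
  rewrite /D ltnNge (ltnW (ltn_trans h1 h2)) /= -(wall_at_seg (ltnW (ltn_trans h1 h2))).
  by rewrite /wpar parity_rev //; apply: wpar_seg; [rewrite h2 ltnW|exact: ltnW].
pose seg := take (b - a) (drop a w).
have segE : (g * elt (take a w) * elt seg = g * elt (take b w))%g.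
  by rewrite -mulgA -elt_cat -takeD subnKC // ltnW.
have [aw ea [U sU UE]] := ia; have [bw eb [V sV VE]] := jb.
have : wpar l (g * elt (take a w))%g seg.
  have lis : nth s0 e l != nth s0 e i by rewrite eq_sym.
  have Pl := parity_star lis (chain_E le) (chain_E ie).
  rewrite /wpar (@parity_eq _ _ adj_sym _ _ _ _ (rev U ++ D ++ V)).
    rewrite !parity_cat (Pl _ _ (rev U)) ?all_rev // (Pl _ _ V) ?eij //.
    have -> : (g * elt (take a w) * elt (rev U) = wall_at i)%g.
      by rewrite elt_rev UE invgM invgK mulVKg.
    by rewrite addbF; exact: Dl.
  apply: (mulgI (g * elt (take a w))%g); rewrite segE !elt_cat elt_rev UE VE.
  by rewrite invgM invgK !mulgA mulgV mul1g DE mulgV mul1g.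
move=> /parity_crosses [k kc]; have [kw _ _] := kc.
have {}kw : k < b - a by move: kw; rewrite size_take_min; lia.
have lc := crosses_sub kc.
(* At time [a] the letter of [w] is the label of the wall [i], so the wall [l] is crossed strictly
   later. *)
have k0 : 0 < k.
  rewrite lt0n; apply/eqP => k0; rewrite k0 addn0 in lc; case: lc => _ el _.
  by move/eqP: eil; apply; rewrite -ea -el; apply: set_nth_default.
have := Hcost ie le eil _ ia lc; lia.
Qed.

(** Crossing times of different walls are at least [F] apart, so their quotients by [F] are distinct
    and at most [size w %/ F]. *)
Lemma chain_count (J : seq nat) : uniq J -> all (fun j => j < size e) J ->
  (forall j, j \in J -> exists a, wcross j g w a) -> size J <= (size w %/ F).+1.
Proof.
move=> uJ /allP Je Jc.
have [t tP] : {t : nat -> nat | forall j, j \in J -> wcross j g w (t j)}.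
  apply: constructive_indefinite_description.
  have /choice [t tP] : forall j, exists a, j \in J -> wcross j g w a.
    move=> j; case: (boolP (j \in J)) => [/Jc [a ja]|]; first by exists a.
    by exists 0.
  by exists t.
have sep i j : i \in J -> j \in J -> t i %/ F = t j %/ F -> i = j.
  move=> iJ jJ tij; apply/eqP/negP => /negP ij.
  have h (a b : nat) : a <= b -> a %/ F = b %/ F -> F <= b - a -> False.
    move=> ab abF; have := divn_eq a F; have := divn_eq b F.
    have := ltn_pmod a F0; have := ltn_pmod b F0; rewrite abF; lia.
  case: (leqP (t i) (t j)) => [tt|/ltnW tt].
    by apply: (h _ _ tt tij); apply: (wcross_sep (Je _ iJ) (Je _ jJ) ij tt); exact: tP.
  apply: (h _ _ tt (esym tij)).
  by apply: (wcross_sep (Je _ jJ) (Je _ iJ) _ tt); rewrite 1?eq_sym //; exact: tP.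
rewrite -(size_map (fun j => t j %/ F) J) -(size_iota 0 (size w %/ F).+1).
apply: uniq_leq_size; first by rewrite map_inj_in_uniq.
move=> _ /mapP[j jJ ->]; rewrite mem_iota /= add0n ltnS.
by apply: leq_div2r; case: (tP _ jJ) => /ltnW.
Qed.

End Chain.

(** * Lower bounds from walls *)

Section Lower.
Variables (S : finType) (adj : rel S).
Hypotheses (adj_sym : symmetric adj) (adj_irr : irreflexive adj).
Local Notation G := (racg adj).
Local Notation elt := (elt adj).
Local Notation star := (star adj).
Local Notation link := (link adj).
Local Notation inspan := (@inspan _ adj).
Local Notation indep := (indep adj).
Implicit Types (u v w e : seq S) (g h x y : G) (s t p : S) (E K : pred S).

(** Every letter of the link commutes with [p], so the occurrences of [p] can be moved to the end
    and cancelled in pairs. *)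
Lemma star_split p g : indep (link p) -> inspan (star p) g ->
  exists e (b : bool), reducedin (link p) e /\ g = elt (e ++ nseq b p).
Proof.
move=> il [w sw <-].
suff [u [b [lu ->]]] : exists u (b : bool), all (link p) u /\ elt w = elt (u ++ nseq b p).
  have [e re eu] := inspanP (inspan_elt adj lu).
  by exists e, b; rewrite !elt_cat eu.
elim/last_ind: w sw => [|w t IH]; first by exists [::], false.
rewrite all_rcons => /andP[st /IH [u [b [lu wu]]]].
rewrite elt_rcons wu; case/orP: st => [/eqP ->|pt].
  exists u, (~~ b); split=> //; rewrite !elt_cat -mulgA; congr (_ * _)%g.
  by case: b {wu}; rewrite /= ?elt_sq // mul1g.
exists (rcons u t), b; split; first by rewrite all_rcons lu andbT.
rewrite !elt_cat elt_rcons -!mulgA; congr (_ * _)%g.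
by case: b {wu} => /=; rewrite ?mul1g ?mulg1 // elt_comm.
Qed.

Variable lev : S -> nat.
Hypothesis adj_lev : forall s t, adj s t -> lev s = (lev t).+1 \/ lev t = (lev s).+1.
Hypothesis common1 : forall s t c c', s != t -> 2 <= lev s -> 2 <= lev t ->
  adj s c -> adj t c -> adj s c' -> adj t c' -> c = c'.

Lemma link_indep p : indep (link p).
Proof.
move=> s t /= /adj_lev ps /adj_lev pt; apply/negP => /adj_lev st.
by case: ps; case: pt; case: st; lia.
Qed.

(** Grows like [r ^ k]: about [r./2] walls, with the cost of one stage less at radius [r./2] between
    consecutive crossings. Two are subtracted, one for the first wall, which may be avoided, and one
    because gaps are counted instead of crossings. *)
Fixpoint wall_cost k r := if k is k'.+1 then (r./2 - 2) * maxn 1 (wall_cost k' r./2) else 0.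

(* Write u as a reduced word e in the link of p. The path crosses every wall met
   by e except possibly the first one; near the base point two such walls are
   joined by a path to which the induction hypothesis applies. *)
Lemma low_bound k : forall r p t E0 (u h v : G) w, indep E0 -> E0 p -> E0 t -> p != t ->
  k < lev p -> k < lev t -> inspan (star p) u -> inspan E0 h -> inspan (star t) v ->
  (u * elt w = h * v)%g ->
  (forall i (x : seq S), i <= size w -> elt x = (u * elt (take i w))%g -> r <= size x) ->
  wall_cost k r <= size w.
Proof.
elim: k => // k IH r p t E0 u h v w iE0 E0p E0t pt kp kt up hE vt uw far.
have il := link_indep (p := p).
have [e0 [b [re0 ue]]] := star_split il up.
have /andP[red0 le0] := re0.
(* The point [u] is at distance at least [r] from the identity, and [e0] lacks at most the final
   letter [p]. *)
have se0 : r <= (size e0).+1.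
  have := far 0 (e0 ++ nseq b p) isT; rewrite take0 elt_nil mulg1 ue => /(_ erefl).
  by rewrite size_cat size_nseq; case: b {ue}; lia.
rewrite /= -/wall_cost; set N := r./2.
have N2 : N + N <= r by rewrite /N addnn -[leqRHS]odd_double_half leq_addl.
have [N3|N3] := leqP N 2; first by move: N3; rewrite -subn_eq0 => /eqP ->.
(* A point reached by at most [N] letters of [e0] is still at distance at least [r - N], hence at
   least [N], from the path. *)
clearbody N; pose e := take N e0; set F := maxn _ _.
have N0 : 0 < N := ltnW (ltnW N3).
have sN : N <= size e0.
  by rewrite -ltnS; apply: leq_trans se0; apply: leq_trans N2; rewrite -addn1 leq_add2l.
have se : size e = N by rewrite /e size_takel.
have re : reducedin (link p) e.
  exact: reducedin_take.
have wE j : j < N -> wall_at e 1%g j = wall_at e0 1%g j.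
  by move=> jN; rewrite /wall_at take_takel // ltnW.
have nE j : j < N -> nth p e j = nth p e0 j by move=> jN; rewrite nth_take.
have [H HE Hh] := hE; have [V Vt Vv] := vt.
(* The word [w] is compared with the way back along [e0], then [H], then [V]. The way back crosses
   wall [j] once, and [H] does not contain its label; what remains is to exclude [V]. *)
have cross j : 0 < j < N -> exists a, wcross e 1%g p j u w a.
  move=> /andP[j0 jN]; apply: parity_crosses.
  set c := nth p e j.
  have pc : adj p c by apply: (chain_E p re); rewrite se.
  have cE0 : ~~ E0 c by apply/negP => E0c; have := iE0 _ _ E0p E0c; rewrite pc.
  have wU : elt w = elt (rev (e0 ++ nseq b p) ++ H ++ V).
    by apply: (mulgI u); rewrite uw !elt_cat elt_rev -ue Hh Vv mulVKg.
  rewrite (parity_eq adj_sym _ _ _ wU) parity_cat parity_cat.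
  have -> : parity (wall_at e 1%g j) c u (rev (e0 ++ nseq b p)) = true.
    have {1}-> : u = (1 * elt (e0 ++ nseq b p))%g by rewrite mul1g.
    rewrite parity_rev // parity_cat [X in _ (+) X]parity_notin; last first.
      rewrite mem_nseq; apply/negP => /andP[_ /eqP cp].
      by rewrite cp adj_irr in pc.
    rewrite addbF wE // /c nE //.
    have := @wpar_seg _ _ adj_irr (link p) e0 1%g p il re0 0 (size e0) j.
    rewrite drop0 take_size /wpar {2}/wall_at take0 mulg1; apply=> //.
    exact: leq_trans jN sN.
  rewrite [parity _ _ _ H]parity_notin; last first.
    by apply/negP => /(allP HE); apply/negP.
  rewrite addFb.
  have -> : (u * elt (rev (e0 ++ nseq b p)) * elt H = h)%g.
    by rewrite elt_rev -ue mulgV mul1g.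
  (* If [V] crosses the wall, its label [c] is the only common neighbour of [p] and [t]. After
     retraction onto the link of [p] only letters [c] are left of [V], so [take j e] is [c] alone
     and letters 0 and 1 of [e] coincide. *)
  rewrite parityN // => i [iV ci].
  rewrite -Hh /wall_at mul1g -elt_rev -!elt_cat => /(inspan_filter (link p)).
  have tc : adj t c.
    have := allP Vt _ (mem_nth c iV); rewrite ci /= => /orP[/eqP ct|//].
    by have := iE0 _ _ E0p E0t; rewrite -ct pc.
  rewrite !filter_cat !elt_cat.
  have -> : seq.filter (link p) H = [::].
    apply/eqP; rewrite -(negbK (_ == _)) -has_filter; apply/hasPn => s /(allP HE) E0s.
    exact: iE0.
  have -> : seq.filter (link p) (rev (take j e)) = rev (take j e).
    by apply/all_filterP; rewrite all_rev; case/andP: (reducedin_take j re).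
  rewrite elt_nil mul1g => /(inspan_sub (K' := pred1 c)) [].
    move=> s /= /andP[/orP[//|cs] ps].
    by have := il _ _ pc ps; rewrite cs.
  move=> z zc zE.
  have : inspan (star c) (elt (take j e)).
    rewrite -[take j e]revK elt_rev; apply: inspanV.
    have -> : elt (rev (take j e)) =
        (elt z * (elt (seq.filter (link p) (take i V)))^-1)%g by rewrite zE mulgK.
    apply: inspanM; first by apply: inspan_elt; apply: sub_all zc => s /= ->.
    apply/inspanV/inspan_elt/allP => s; rewrite mem_filter => /andP[] /= ps.
    move=> /mem_take /(allP Vt) /= /orP[/eqP st|ts].
      by have := iE0 _ _ E0p E0t; rewrite -st ps.
    have -> : s = c.
      by apply: (common1 (s := p) (t := t)) => //; [exact: leq_trans kp|exact: leq_trans kt].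
    by rewrite eqxx.
  have rt : reducedin (link p) (take j e).
    exact: reducedin_take.
  have st : size (take j e) = j by rewrite size_take se jN.
  case/(star_indep adj_irr il pc rt) => te; rewrite te /= in st.
    by rewrite -st in j0.
  have cE : c = nth p e 1 by rewrite /c -st.
  have jN1 : 1 < N by rewrite st.
  have := @reduced_neq _ _ _ p re 0; rewrite se -cE => /(_ jN1) /negP; apply.
  have : nth p (take j e) 0 = c by rewrite te.
  by rewrite nth_take // => ->.
(* Seen from the start of edge [i], the stretch of [w] between the crossings fulfils the induction
   hypothesis, with the link of [p] as the independent set. *)
have Hcost i l a b' : i < size e -> l < size e -> nth p e i != nth p e l -> a < b' ->
    wcross e 1%g p i u w a -> wcross e 1%g p l u w b' -> F <= b' - a.
  rewrite se => iN lN il' ab [aw _ ai] [bw _ bl].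
  rewrite geq_max subn_gt0 ab /=.
  pose w' := take (b' - a) (drop a w).
  have sw' : size w' = b' - a.
    by rewrite size_takel // size_drop leq_sub2r // ltnW.
  have lvl j : j < N -> k < lev (nth p e j).
    rewrite -se => /(chain_E p re) /= /adj_lev [pl|->]; first by rewrite -ltnS -pl.
    by rewrite ltnS ltnW // ltnW.
  rewrite -sw'.
  apply: (IH N (nth p e i) (nth p e l) (link p) _
    ((wall_at e 1 i)^-1 * wall_at e 1 l)%g _ w' il _ _ il' (lvl _ iN) (lvl _ lN) ai _ bl).
  - by apply: (chain_E p re); rewrite se.
  - by apply: (chain_E p re); rewrite se.
  - apply: inspanM; [apply: inspanV|]; rewrite /wall_at mul1g; exact: inspan_take.
  - rewrite -(mulgA _ (wall_at e 1 l)) mulVKg -(mulgA _ (u * _)%g) -(mulgA u).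
    by rewrite -elt_cat -takeD subnKC // ltnW.
  - move=> i' x; rewrite sw' => i'b xE.
    have aw' : a + i' <= size w.
      by apply: leq_trans (ltnW bw); rewrite -(subnKC (ltnW ab)) leq_add2l.
    have := far (a + i') (take i e ++ x) aw'.
    rewrite elt_cat xE takeD /w' take_takel // !mulgA.
    rewrite /wall_at mul1g mulgV mul1g elt_cat mulgA => /(_ erefl).
    rewrite size_cat size_takel ?se ?(ltnW iN) // => rx.
    have := leq_trans N2 (leq_trans rx (leq_add (ltnW iN) (leqnn _))).
    by rewrite leq_add2l.
have uJ : uniq (iota 1 N.-1) by exact: iota_uniq.
have := chain_count adj_sym adj_irr il re (leq_maxl 1 _ : 0 < F) Hcost uJ.
rewrite size_iota => cc.
have {}cc : N.-1 <= (size w %/ F).+1.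
  apply: cc.
    by apply/allP => j; rewrite mem_iota add1n prednK // se => /andP[].
  by move=> j; rewrite mem_iota add1n prednK //; exact: cross.
apply: leq_trans (leq_divM (size w) F).
by rewrite leq_mul2r leq_subLR add2n -{1}(prednK N0) ltnS cc orbT.
Qed.

End Lower.

Section LowerTop.
Variables (S : finType) (adj : rel S).
Hypotheses (adj_sym : symmetric adj) (adj_irr : irreflexive adj).
Local Notation G := (racg adj).
Local Notation elt := (elt adj).
Local Notation inspan := (@inspan _ adj).
Local Notation indep := (indep adj).
Implicit Types (u v w e : seq S) (g h x y : G) (s t p : S) (E K : pred S).

Variable lev : S -> nat.
Hypothesis adj_lev : forall s t, adj s t -> lev s = (lev t).+1 \/ lev t = (lev s).+1.
Hypothesis common1 : forall s t c c', s != t -> 2 <= lev s -> 2 <= lev t ->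
  adj s c -> adj t c -> adj s c' -> adj t c' -> c = c'.

(** Since [w] has the endpoints of [rev q1 ++ e ++ q2], each wall of [e] is crossed by [q1], [q2] or
    [w]. The ends [q1] and [q2] meet at most [D.+1] walls each, and [low_bound] prices the gaps
    between crossings by [w]; the last unit of [2 * D + 3] is the passage from crossings to gaps. *)
Lemma low_bound_subgroup k E r D g w h e q1 q2 :
  indep E -> (forall s, E s -> k < lev s) -> inspan E h -> reducedin E e ->
  (h * elt q1)%g = g -> (h * elt e * elt q2)%g = (g * elt w)%g ->
  size q1 <= D -> size q2 <= D ->
  (forall i (x : seq S) y, i <= size w -> inspan E y ->
     (y * elt x)%g = (g * elt (take i w))%g -> r <= size x) ->
  (size e - (2 * D + 3)) * maxn 1 (wall_cost k r) <= size w.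
Proof.
move=> iE lE hE re hg hw sq1 sq2 far.
case: (posnP (size e)) => [->//|e_gt0].
have [s0 s0e] : exists s0, s0 \in e by case: e e_gt0 {re hw} => // s e; exists s; rewrite mem_head.
(* With unit cost, [chain_count] bounds the number of walls met by any word by its length plus
   one. *)
have triv g' w' i l a b : i < size e -> l < size e -> nth s0 e i != nth s0 e l ->
    a < b -> wcross e h s0 i g' w' a -> wcross e h s0 l g' w' b -> 1 <= b - a.
  by move=> _ _ _ ab _ _; rewrite subn_gt0.
pose n := size e.
pose J g' w' := [seq j <- iota 0 n | wpar e h s0 j g' w'].
have uJ g' w' : uniq (J g' w') by rewrite filter_uniq ?iota_uniq.
have aJ g' w' : all (fun j => j < size e) (J g' w').
  by apply/allP => j; rewrite mem_filter mem_iota /n => /andP[_].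
have cJ g' w' j : j \in J g' w' -> exists a, wcross e h s0 j g' w' a.
  by rewrite mem_filter => /andP[/parity_crosses].
have s1 g' w' : size (J g' w') <= (size w').+1.
  have := chain_count adj_sym adj_irr iE re (ltnSn 0) (@triv g' w')
    (uJ g' w') (aJ g' w') (@cJ g' w').
  by rewrite divn1.
set F := maxn _ _.
have sw : size (J g w) <= (size w %/ F).+1.
  apply: (chain_count adj_sym adj_irr iE re (leq_maxl 1 _ : 0 < F) _ (uJ g w) (aJ g w) (@cJ g w)).
  move=> i l a b' iN lN il' ab [aw _ ai] [bw _ bl].
  rewrite geq_max subn_gt0 ab /=.
  pose w' := take (b' - a) (drop a w).
  have sw' : size w' = b' - a.
    by rewrite size_take_min size_drop; apply/minn_idPl; rewrite leq_sub2r // ltnW.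
  rewrite -sw'.
  have Ei := chain_E s0 re iN; have El := chain_E s0 re lN.
  have sub i' : inspan E (wall_at e h i') by apply: inspanM => //; exact: inspan_take.
  apply: (low_bound adj_sym adj_irr adj_lev common1 iE Ei El il' (lE _ Ei) (lE _ El) ai
    (_ : inspan E ((wall_at e h i)^-1 * wall_at e h l)%g) bl).
  - by apply: inspanM; [exact: inspanV|].
  - rewrite -(mulgA _ (wall_at e h l)) mulVKg -(mulgA _ (g * _)%g) -(mulgA g).
    by rewrite -elt_cat -takeD subnKC // ltnW.
  - move=> i' x; rewrite sw' => i'b xE.
    apply: (far (a + i') x (wall_at e h i)) => //.
      by apply: leq_trans (ltnW bw); rewrite -(subnKC (ltnW ab)) leq_add2l.
    by rewrite xE takeD /w' take_takel // elt_cat -(mulgA _ (g * _)%g) mulVKg mulgA.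
have all_in : {subset iota 0 n <= J h q1 ++ J (h * elt e)%g q2 ++ J g w}.
  move=> j jn; rewrite !mem_cat !mem_filter jn !andbT.
  have wE : elt w = elt (rev q1 ++ e ++ q2).
    apply: (mulgI g); rewrite -hw -hg !elt_cat elt_rev -!mulgA; congr (_ * _)%g.
    by rewrite mulVKg.
  rewrite [wpar _ _ _ _ g w]/wpar (parity_eq adj_sym _ _ _ wE) !parity_cat -hg parity_rev //.
  rewrite elt_rev mulgK.
  have := @wpar_seg _ _ adj_irr E e h s0 iE re 0 (size e) j.
  rewrite drop0 take_size /wpar {2}/wall_at take0 mulg1 => -> //; last first.
    by rewrite mem_iota in jn.
  by case: (parity _ _ _ q1); case: (parity _ _ _ q2).
have := uniq_leq_size (iota_uniq 0 n) all_in.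
rewrite size_iota !size_cat => nle.
have l1 := s1 h q1; have l2 := s1 (h * elt e)%g q2.
apply: leq_trans (leq_divM (size w) F); rewrite leq_mul2r; apply/orP; right.
rewrite leq_subLR; apply: (leq_trans nle).
have -> : 2 * D + 3 + size w %/ F = D.+1 + (D.+1 + (size w %/ F).+1).
  by move: (size w %/ F) => q; lia.
by rewrite !leq_add // (leq_trans l1, leq_trans l2) // ltnS.
Qed.

End LowerTop.

(** * Detours along rays *)

Section Upper.
Variables (S : finType) (adj : rel S).
Local Notation G := (racg adj).
Local Notation elt := (elt adj).
Local Notation inspan := (@inspan _ adj).
Local Notation indep := (indep adj).
Implicit Types (w e : seq S) (g h x y : G) (s t p : S) (E K : pred S) (Q : G -> Prop).

Definition path_within Q n g h :=
  exists w, [/\ size w <= n, h = (g * elt w)%g & forall i, Q (g * elt (take i w))%g].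

Lemma conn_refl Q n g : Q g -> path_within Q n g g.
Proof. by move=> Qg; exists [::]; split; rewrite ?mulg1 // => i; rewrite mulg1. Qed.

Lemma conn_start Q n g h : path_within Q n g h -> Q g.
Proof. by move=> [w [_ _ /(_ 0)]]; rewrite take0 mulg1. Qed.

Lemma conn_step Q s g : Q g -> Q (g * elt [:: s])%g -> path_within Q 1 g (g * elt [:: s])%g.
Proof.
by move=> Qg Qgs; exists [:: s]; split=> // -[|i] //=; rewrite ?mulg1 // take_nil.
Qed.

Lemma conn_trans Q m n g h k :
  path_within Q m g h -> path_within Q n h k -> path_within Q (m + n) g k.
Proof.
move=> [u [su -> Qu]] [v [sv -> Qv]]; exists (u ++ v); split.
- by rewrite size_cat leq_add.
- by rewrite elt_cat mulgA.
- move=> i; rewrite take_cat; case: ltnP => _; first exact: Qu.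
  by rewrite elt_cat mulgA; exact: Qv.
Qed.

Lemma conn_sym Q n g h : path_within Q n g h -> path_within Q n h g.
Proof.
move=> [u [su -> Qu]]; exists (rev u); split; rewrite ?size_rev //.
  by rewrite elt_rev mulgK.
move=> i; rewrite take_rev elt_rev -{1}(cat_take_drop (size u - i) u) elt_cat mulgA.
by rewrite mulgK; exact: Qu.
Qed.

Lemma conn_mull (Q Q' : G -> Prop) n a g h : (forall x, Q x -> Q' (a * x)%g) ->
  path_within Q n g h -> path_within Q' n (a * g)%g (a * h)%g.
Proof.
move=> QQ' [u [su -> Qu]]; exists u; split=> //; first by rewrite mulgA.
by move=> i; rewrite -mulgA; exact: QQ'.
Qed.

Lemma conn_sub (Q Q' : G -> Prop) m n g h : (forall x, Q x -> Q' x) -> m <= n ->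
  path_within Q m g h -> path_within Q' n g h.
Proof.
move=> QQ' mn [u [su -> Qu]]; exists u; split=> //; first exact: leq_trans mn.
by move=> i; exact: QQ'.
Qed.

Variable lev : S -> nat.
Hypothesis adj_lev : forall s t, adj s t -> lev s = (lev t).+1 \/ lev t = (lev s).+1.
Variables (ch : S -> bool -> S) (good : pred S).
Hypothesis good_adj : forall s b, good s -> adj s (ch s b).
Hypothesis good_lev : forall s b, good s -> lev s = (lev (ch s b)).+1.
Hypothesis good_neq : forall s, good s -> ch s false != ch s true.
Hypothesis good_ch : forall s b, good s -> 2 <= lev s -> good (ch s b).
Hypothesis good_bot : forall s t, good s -> good t -> lev s = 1 -> lev t = 1 ->
  ch s =1 ch t.

Implicit Types f : bool -> S.

Definition alternating f n := mkseq (fun i => f (odd i)) n.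
Definition pair2 f : pred S := pred2 (f false) (f true).

Lemma alt_S f n : alternating f n.+1 = rcons (alternating f n) (f (odd n)).
Proof. by rewrite /alternating mkseqS. Qed.

Lemma all_alt (P : pred S) f n : (forall b, P (f b)) -> all P (alternating f n).
Proof. by move=> Ps; apply/allP => _ /mapP[i _ ->]. Qed.

Lemma alt_reduced f n : f false != f true -> reducedin (pair2 f) (alternating f n).
Proof.
move=> s01; apply/andP; split; last first.
  by apply: all_alt => -[]; rewrite /pair2 /= eqxx ?orbT.
apply/(sortedP (f false)) => i; rewrite size_mkseq => i1.
rewrite !nth_mkseq //; last exact: ltnW.
by rewrite /=; case: (odd i); rewrite //= eq_sym.
Qed.

Lemma lev_indep E l : (forall s, E s -> lev s = l) -> indep E.
Proof.
move=> El s t /El sl /El tl; apply/negP => /adj_lev; rewrite sl tl; lia.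
Qed.

(** A certificate that [g] is at distance at least [r] from the subgroup spanned by the letters of
    level at least [l]: the retraction onto [E] kills that subgroup, so left translation by it
    changes nothing. *)
Definition safe l r g := exists E, [/\ indep E, forall s, E s -> lev s < l &
  forall w, elt w = g -> r <= size (nf E w)].

Lemma safe_mull l r a g : inspan (fun s => l <= lev s) a -> safe l r g -> safe l r (a * g)%g.
Proof.
move=> [u lu <-] [E [iE El Er]]; exists E; split=> // w wE.
have -> : nf E w = nf E (rev u ++ w).
  rewrite nf_cat_out // all_rev; apply: sub_all lu => s /= ls.
  by apply/negP => /El; rewrite ltnNge ls.
by apply: Er; rewrite elt_cat elt_rev wE mulKg.
Qed.

Lemma safe_le l l' r g : l <= l' -> safe l r g -> safe l' r g.
Proof.
move=> ll' [E [iE El Er]]; exists E; split=> // s /El sl; exact: leq_trans ll'.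
Qed.

(** The retraction onto the two children of [s] erases [x], whose letters have lower level, and
    keeps the whole ray. *)
Lemma safe_ray s r x : good s -> inspan (fun t => lev t < (lev s).-1) x ->
  safe (lev s) r (elt (alternating (ch s) r) * x)%g.
Proof.
move=> gs [u su <-]; have ls t : pair2 (ch s) t -> (lev t).+1 = lev s.
  by case/orP => /eqP ->; rewrite -good_lev.
have iE : indep (pair2 (ch s)).
  by apply: (@lev_indep _ (lev s).-1) => t /ls <-.
exists (pair2 (ch s)); split=> // [t /ls <- //|w].
rewrite -elt_cat => /(nf_eq iE) ->.
rewrite /nf foldl_cat -/(nf _ _) foldl_push_out; last first.
  apply: sub_all su => t /= tl; apply/negP => /ls lt.
  by rewrite -lt ltnn in tl.
by rewrite nf_id ?size_rev ?size_mkseq //; apply/alt_reduced/good_neq.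
Qed.

Lemma safe_ray0 s r : good s -> safe (lev s) r (elt (alternating (ch s) r)).
Proof. by move=> gs; rewrite -[elt _]mulg1; apply: safe_ray => //; exact: inspan1. Qed.

Lemma elt_ray_comm s r : good s ->
  (elt [:: s] * elt (alternating (ch s) r) = elt (alternating (ch s) r) * elt [:: s])%g.
Proof.
move=> gs; elim: r => [|r IH]; first by rewrite mul1g mulg1.
by rewrite alt_S elt_rcons mulgA IH -!mulgA (elt_comm (good_adj _ gs)).
Qed.

(** Grows like [r ^ k]. For each of the two rays, [r] steps append a ray one level lower and the
    inner sum is the price of [stair]; the final summand joins the two lower rays. *)
Fixpoint ray_detour k r := if k is k'.+1 then
  2 * (r + (r * (ray_detour k' r + 1) + ray_detour k' r)) + ray_detour k' r else 0.

(* Climbing down along [alternating f j]: each step moves to the ray that commutes with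
   the last letter and then removes that letter. *)
Lemma stair Q U f r j b : (forall b, good (f b)) ->
  (forall i b b', path_within Q U (elt (alternating f i) * elt (alternating (ch (f b)) r))%g
                           (elt (alternating f i) * elt (alternating (ch (f b')) r))%g) ->
  path_within Q (j * (U + 1) + U) (elt (alternating f j) * elt (alternating (ch (f b)) r))%g
    (elt (alternating (ch (f false)) r)).
Proof.
move=> gf cQ; elim: j b => [|j IHj] b; first by have := cQ 0 b false; rewrite !mul1g.
rewrite mulSn -!addnA; apply: conn_trans (cQ _ _ (odd j)) _.
have e : (elt (alternating f j) * elt (alternating (ch (f (odd j))) r) =
    elt (alternating f j.+1) * elt (alternating (ch (f (odd j))) r) * elt [:: f (odd j)])%g.
  rewrite alt_S elt_rcons -!mulgA; congr (_ * _)%g.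
  by rewrite -elt_ray_comm // mulgA elt_sq mul1g.
apply: conn_trans (IHj (odd j)); rewrite e.
by apply: conn_step; rewrite -?e; [exact: conn_start (cQ _ _ b)|exact: conn_start (cQ _ _ b)].
Qed.

(** At level one the children are the same, so the two rays coincide. Above it, the rays of [s] and
    [t] are led to those of [ch s false] and [ch t false], which are joined by induction. *)
Lemma ray_conn k s t r : good s -> good t -> lev s = k.+1 -> lev t = k.+1 ->
  path_within (safe k.+1 r) (ray_detour k r)
    (elt (alternating (ch s) r)) (elt (alternating (ch t) r)).
Proof.
elim: k s t => [|k IH] s t gs gt ls lt.
  have -> : alternating (ch t) r = alternating (ch s) r.
    by apply: eq_mkseq => i; rewrite (good_bot gs gt).
  by apply: conn_refl; rewrite -ls; exact: safe_ray0.
have half s' : good s' -> lev s' = k.+2 ->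
  path_within (safe k.+2 r) (r + (r * (ray_detour k r + 1) + ray_detour k r))
    (elt (alternating (ch s') r)) (elt (alternating (ch (ch s' false)) r)).
  move=> {s t gs gt ls lt} {}gs ls.
  have gc b : good (ch s' b) by apply: good_ch; rewrite ?ls.
  have lc b : lev (ch s' b) = k.+1.
    by have := good_lev b gs; rewrite ls => -[].
  have mulsafe j x : safe k.+1 r x -> safe k.+2 r (elt (alternating (ch s') j) * x)%g.
    move=> sx; apply: (safe_le (leqnSn _)); apply: safe_mull sx.
    by apply: inspan_elt; apply: all_alt => b; rewrite lc.
  have sc b : safe k.+1 r (elt (alternating (ch (ch s' b)) r)).
    by have := safe_ray0 r (gc b); rewrite lc.
  (* First the lower ray is appended, then [stair] removes the upper ray letter by letter underneath
     it. *)
  apply: (@conn_trans _ _ _ _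
    (elt (alternating (ch s') r) * elt (alternating (ch (ch s' false)) r))%g).
    exists (alternating (ch (ch s' false)) r); split=> //; first by rewrite size_mkseq.
    move=> i; rewrite -ls; apply: safe_ray => //; apply: inspan_elt.
    apply/allP => z /mem_take; move: z; apply/allP.
    apply: all_alt => b; rewrite ls -(lc false) (good_lev b (gc false)) //.
  apply: stair => // i b b'.
  by apply: conn_mull (IH _ _ (gc b) (gc b') (lc _) (lc _)); exact: mulsafe.
have gc s' b : good s' -> lev s' = k.+2 -> good (ch s' b).
  by move=> gs' ls'; apply: good_ch; rewrite ?ls'.
have lc s' b : good s' -> lev s' = k.+2 -> lev (ch s' b) = k.+1.
  by move=> gs' ls'; have := good_lev b gs'; rewrite ls' => -[].
pose D := r + (r * (ray_detour k r + 1) + ray_detour k r).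
apply: (conn_sub (m := D + (ray_detour k r + D)) (fun x (h : safe k.+2 r x) => h)).
  by rewrite /= -/D; lia.
apply: conn_trans (half _ gs ls) _; apply: conn_trans (conn_sym (half _ gt lt)).
have := IH _ _ (gc _ false gs ls) (gc _ false gt lt) (lc _ _ gs ls) (lc _ _ gt lt).
by apply: conn_sub => // x; exact: safe_le.
Qed.

(** The detour leads from the end of a ray based at [alternating f n] to the end of the same ray
    based at the identity. *)
Lemma upper_path k E f r n : (forall t, E t -> lev t = k.+1) ->
  (forall b, E (f b)) -> (forall b, good (f b)) -> f false != f true ->
  exists g w q1 q2 h1 h2, [/\ inspan E h1, inspan E h2,
   (h1 * elt q1)%g = g, (h2 * elt q2)%g = (g * elt w)%g &
   [/\ size q1 <= r, size q2 <= r, size w <= n * (ray_detour k r + 1) + ray_detour k r,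
    forall x : seq S, elt x = elt w -> n <= size x &
    forall i h (x : seq S), inspan E h -> (h * elt x)%g = (g * elt (take i w))%g -> r <= size x]].
Proof.
move=> lE Ef gf f01.
pose Q g := forall h (x : seq S), inspan E h -> (h * elt x)%g = g -> r <= size x.
have safeQ a x : inspan E a -> safe k.+1 r x -> Q (a * x)%g.
  move=> Ea sx h u Eh hu.
  have : safe k.+1 r (h^-1 * a * x)%g.
    apply: safe_mull sx; apply: (@inspan_sub _ _ E) => [t /lE -> //|].
    by apply: inspanM => //; exact: inspanV.
  rewrite -mulgA -hu mulKg => -[F [_ _]] /(_ _ erefl) /leq_trans; apply.
  exact: size_nf.
have lf b : lev (f b) = k.+1 by exact: lE.
have Ealt j : inspan E (elt (alternating f j)) by apply/inspan_elt/all_alt.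
have [|w [sw wE Qw]] := @stair Q (ray_detour k r) f r n false gf.
  move=> i b b'; apply: conn_mull (ray_conn r (gf b) (gf b') (lf b) (lf b')) => x.
  by apply: safeQ; exact: Ealt.
exists (elt (alternating f n) * elt (alternating (ch (f false)) r))%g, w.
exists (alternating (ch (f false)) r), (alternating (ch (f false)) r), (elt (alternating f n)), 1%g.
split=> //; [exact: inspan1|by rewrite mul1g|].
split; rewrite ?size_mkseq //.
move=> x xw.
(* The rays avoid both letters of [f], so the retraction onto these letters maps [w] to the full
   reversed alternating word of length [n]. *)
have iE : indep (pair2 f) by apply: (@lev_indep _ k.+1) => t /orP[] /eqP ->.
have out : all (predC (pair2 f)) (alternating (ch (f false)) r).
  apply: all_alt => b; have := good_lev b (gf false); rewrite lf => -[lc].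
  by apply/negP => /orP[] /eqP cE; move: lc; rewrite cE lf; lia.
have : elt (alternating (ch (f false)) r ++ x) =
    elt (rev (alternating f n) ++ alternating (ch (f false)) r).
  by apply: (mulgI (elt (alternating f n))); rewrite !elt_cat elt_rev mulVKg xw mulgA -wE.
move=> /(nf_eq iE).
rewrite nf_cat_out // /nf [in RHS]foldl_cat [RHS]foldl_push_out // -!/(nf _ _) => nx.
apply: leq_trans (size_nf (pair2 f) x); rewrite nx.
have re : reducedin (pair2 f) (rev (alternating f n)).
  have /andP[ra aa] := alt_reduced n f01.
  by apply/andP; rewrite reduced_rev all_rev.
by rewrite nf_id // size_rev size_rev size_mkseq.
Qed.

End Upper.

(** * Special subgroups generated by independent sets *)

(** [group_F] has the relators of the right-angled Coxeter group of the edgeless graph on three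
    vertices, whose reduced forms it inherits. *)
Lemma F_reduced (x : group_F) : exists2 e : seq 'I_3, reduced e &
  x = class_of F_rel [seq gen i | i <- e].
Proof.
pose adj0 : rel 'I_3 := fun _ _ => false.
have F0 u v : word_eq (racg_rel adj0) u v -> word_eq F_rel u v.
  elim=> {u v} [u|u v _|v u w _ uv _ vw|u u' v v' _ uu' _ vv'|s b|u v [s|s t //]].
  - exact: word_eq_refl.
  - exact: word_eq_sym.
  - exact: word_eq_trans vw.
  - exact: word_eq_cat.
  - exact: word_eq_cancel.
  - by apply: word_eq_rel; exact: F_rel_sq.
rewrite -[x]class_of_repr; set u := repr x.
have /inspanP [e /andP[re _] eu] : inspan predT (class_of (racg_rel adj0) u).
  by rewrite class_of_elt; apply: inspan_elt; apply/allP.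
by exists e => //; apply/class_ofP/F0/class_ofP; exact: esym eu.
Qed.

Section FreeProduct.
Variables (S : finType) (adj : rel S).
Hypotheses (adj_sym : symmetric adj) (adj_irr : irreflexive adj).
Local Notation G := (racg adj).
Local Notation elt := (elt adj).
Local Notation inspan := (@inspan _ adj).
Local Notation indep := (indep adj).
Implicit Types (w e : seq S) (g h x y : G) (s t p : S) (E K : pred S).

Lemma inspan_subgroup E : is_subgroup [set g | inspan E g].
Proof.
split; [exact: inspan1|by move=> x y; exact: inspanM|by move=> x; exact: inspanV].
Qed.

Lemma elt_inspan1 s z : all (pred1 s) z -> elt z = 1%g \/ elt z = elt [:: s].
Proof.
elim: z => [|t z IH] /=; first by left.
move=> /andP[/eqP -> /IH [] zE]; rewrite (elt_cons adj s z) zE ?mulg1; first by right.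
by left; rewrite elt_sq.
Qed.

Lemma special_inspan (J : {set S}) g : special_subgroup J g -> inspan [in J] g.
Proof.
apply; split; first exact: inspan_subgroup.
by move=> _ [s sJ <-]; exists [:: s]; rewrite //= andbT.
Qed.

(** Two vertices of [E] in a join would be adjacent or have a common neighbour. So a join meets [E]
    in at most one letter, and the retraction onto [E] shows that an element conjugate into its
    subgroup has square 1. *)
Lemma inspan_join_free E a b : indep E -> E a -> E b -> a != b ->
  (forall s t c, E s -> E t -> s != t -> adj s c -> adj t c -> False) ->
  join_free [set g | inspan E g].
Proof.
move=> iE Ea Eb ab nc; split.
  pose f c := if c then b else a.
  pose len (g : G) := size (nf E (projT1 (cid (elt_surj g)))).
  move=> /(finite_image len); apply: contra_not infinite_nat.
  apply: sub_finite_set => n _; exists (elt (alternating f n)).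
    by apply: inspan_elt; apply: all_alt; case.
  have fE s : pair2 f s -> E s by case/orP => /eqP ->.
  have rE : reducedin E (alternating f n).
    have /andP[rn an] := @alt_reduced _ f n ab.
    by apply/andP; split=> //; exact: sub_all an.
  rewrite /len; case: cid => w /= /(nf_eq iE) ->.
  by rewrite nf_id // size_rev size_mkseq.
move=> _ [u Eu <-] io [g [J [[A [B [A0 B0 AB0 ABJ AB]]] /special_inspan]]].
have [v <-] := elt_surj g.
have -> : (elt u ^ elt v)%g = elt (rev v ++ u ++ v).
  by rewrite !elt_cat elt_rev.
have [[s [t [Es Et st sJ tJ]]]|no] :=
    pselect (exists s t, [/\ E s, E t, s != t, s \in J & t \in J]).
  move=> _; move: sJ tJ; rewrite -ABJ !inE.
  have sAB (c c' : S) : c \in A -> c' \in B -> E c -> E c' -> False.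
    by move=> cA cB Ec Ec'; have := iE _ _ Ec Ec'; rewrite AB.
  have [c cA] := set0Pn _ A0; have [c' cB] := set0Pn _ B0.
  move=> /orP[sA|sB] /orP[tA|tB].
  - by apply: (nc s t c') => //; exact: AB.
  - exact: (sAB _ _ sA tB).
  - exact: (sAB _ _ tA sB).
  - by apply: (nc s t c) => //; rewrite adj_sym; exact: AB.
move=> /(inspan_filter E) [z Jz].
have -> : seq.filter E (rev v ++ u ++ v) = rev (seq.filter E v) ++ u ++ seq.filter E v.
  by rewrite !filter_cat filter_rev; congr (_ ++ (_ ++ _)); exact/all_filterP.
have [s Js] : exists s, all (pred1 s) z.
  case: z Jz => [|s z Jz]; first by exists a.
  exists s; apply/allP => t tz; apply/eqP.
  have /andP[tJ Et] := allP Jz _ tz; have /andP[sJ Es] := allP Jz _ (mem_head _ _).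
  by apply: contra_notP no => /eqP ts; exists t, s.
rewrite !elt_cat elt_rev => zE.
apply: (io 2) => //; rewrite expgS expg1.
have -> : elt u = (elt (seq.filter E v) * elt z * (elt (seq.filter E v))^-1)%g.
  by rewrite zE mulVKg mulgK.
rewrite !mulgA mulgVK -(mulgA _ (elt z) (elt z)).
by have [->|->] := elt_inspan1 Js; rewrite ?elt_sq !mulg1 mulgV.
Qed.

Variable f : 'I_3 -> S.

Lemma F_word_elt (u v : word 'I_3) : word_eq F_rel u v ->
  elt [seq f l.1 | l <- u] = elt [seq f l.1 | l <- v].
Proof.
elim=> {u v} //= [v u w _ IH1 _ IH2|u u' v v' _ IH1 _ IH2|s b|u v [s]] //=.
- by rewrite IH1 IH2.
- by rewrite !map_cat !elt_cat IH1 IH2.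
- by rewrite elt_cons elt_sq.
- by rewrite elt_cons elt_sq.
Qed.

Definition F_embed (x : group_F) : G := elt [seq f l.1 | l <- repr x].

Lemma F_embed_class u : F_embed (class_of F_rel u) = elt [seq f l.1 | l <- u].
Proof. by apply: F_word_elt; exact: repr_class_of. Qed.

Fact F_embedM : {morph F_embed : x y / (x * y)%g}.
Proof.
move=> x y; rewrite -[x]class_of_repr -[y]class_of_repr.
by rewrite [(_ * _)%g]presented_mulE !F_embed_class map_cat elt_cat.
Qed.

HB.instance Definition _ := isMultiplicative.Build group_F G F_embed F_embedM.

Lemma F_embed_inj : injective f -> indep [pred s | s \in codom f] -> injective F_embed.
Proof.
move=> fI iE x y; have [e re ->] := F_reduced x; have [e' re' ->] := F_reduced y.
rewrite !F_embed_class -!map_comp => ee'.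
have rE i : reduced i -> reducedin [pred s | s \in codom f] (map f i).
  move=> ri; apply/andP; split; last by apply/allP => _ /mapP[j _ ->]; exact: codom_f.
  rewrite /reduced sorted_map; move: ri; apply: sub_sorted => s t /=.
  by rewrite inj_eq.
congr (class_of _ (map _ _)); apply: (inj_map fI).
exact: reduced_inj iE (rE _ re) (rE _ re') ee'.
Qed.

Lemma inspan_isomorphic E : injective f -> indep E -> (forall s, E s <-> exists i, s = f i) ->
  subgroup_isomorphic group_F [set g | inspan E g].
Proof.
move=> fI iE Ef; have Ec s : E s = (s \in codom f).
  by apply/idP/codomP => [/Ef|/Ef].
exists F_embed; split.
  by apply: F_embed_inj => // s t /=; rewrite -!Ec; exact: iE.
apply/seteqP; split=> [_ [x _ <-]|_ [w Ew <-]].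
  by apply: inspan_elt; apply/allP => _ /mapP[l _ ->]; apply/Ef; exists l.1.
have [e <-] : exists e : seq 'I_3, map f e = w.
  elim: w Ew => [|s w IH] /=; first by exists [::].
  by move=> /andP[/Ef [i ->] /IH [e <-]]; exists (i :: e).
exists (class_of F_rel [seq gen i | i <- e]) => //.
by apply: (etrans (F_embed_class _)); rewrite -map_comp.
Qed.

End FreeProduct.

(** * The defining graph *)

Section Tree.
Variable d : nat.

(* The vertex (i, j) has level i. For i > 0 its parent is (i + 1, j / 2), while
   (0, 0) and (0, 1) are joined to all vertices of level 1 and the other vertices
   of level 0 are isolated. *)

Definition tree_size := 5 * 2 ^ d.
Definition tree_vertex := ('I_d.+1 * 'I_tree_size)%type.
Implicit Types s t c : tree_vertex.

Definition lev s : nat := s.1.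
Definition pos s : nat := s.2.

Definition up s t := (lev t == (lev s).+1) &&
  (if lev s == 0 then pos s < 2 else pos t == (pos s)./2).
Definition tree_adj : rel tree_vertex := fun s t => up s t || up t s.

Lemma vertex_eq s t : lev s = lev t -> pos s = pos t -> s = t.
Proof.
by case: s t => [i j] [i' j']; rewrite /lev /pos /= => /val_inj -> /val_inj ->.
Qed.

Lemma tree_adj_sym : symmetric tree_adj.
Proof. by move=> s t; rewrite /tree_adj orbC. Qed.

Lemma tree_adj_lev s t : tree_adj s t -> lev s = (lev t).+1 \/ lev t = (lev s).+1.
Proof. by case/orP => /andP[/eqP -> _]; [right|left]. Qed.

Lemma tree_adj_irr : irreflexive tree_adj.
Proof. by move=> s; apply/negP => /tree_adj_lev []; lia. Qed.

Lemma up_pos s t : up s t -> lev t = (lev s).+1 /\ (lev s = 0 \/ pos t = (pos s)./2).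
Proof.
by case/andP => /eqP ->; case: eqP => [->|_ /eqP ->]; split; auto.
Qed.

(** A vertex of positive level has at most one parent, so a common neighbour cannot lie below both.
    It is the parent of a lower one of the two, hence determined. *)
Lemma tree_common s t c c' : s != t -> 2 <= lev s -> 2 <= lev t ->
  tree_adj s c -> tree_adj t c -> tree_adj s c' -> tree_adj t c' -> c = c'.
Proof.
move=> st ls lt sc tc sc' tc'.
have noeq : ~ (lev s = lev t /\ pos s = pos t).
  by move=> [l p]; move/eqP: st; apply; exact: vertex_eq.
by apply: vertex_eq; move: sc tc sc' tc' =>
  /orP[] /up_pos + /orP[] /up_pos + /orP[] /up_pos + /orP[] /up_pos; lia.
Qed.

Lemma tree_size_gt4 : 4 < tree_size.
Proof. by rewrite /tree_size (leq_mul2l 5 1) expn_gt0. Qed.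

Definition vertex i j : tree_vertex := (inord i, insubd (Ordinal tree_size_gt4) j).

Lemma lev_vertex i j : i <= d -> lev (vertex i j) = i.
Proof. by move=> id; rewrite /lev /vertex /= inordK. Qed.

Lemma pos_vertex i j : j < tree_size -> pos (vertex i j) = j.
Proof. by move=> jn; rewrite /pos /vertex /= val_insubd jn. Qed.

Definition child s (b : bool) :=
  vertex (lev s).-1 (if lev s == 1 then b : nat else (pos s).*2 + b).

(* All descendants of the vertex have two children. *)
Definition good : pred tree_vertex :=
  fun s => (0 < lev s) && ((pos s).+1 * 2 ^ (lev s).-1 <= tree_size).

Lemma lev_le s : lev s <= d. Proof. by rewrite /lev -ltnS ltn_ord. Qed.

Lemma lev_child s b : lev (child s b) = (lev s).-1.
Proof. by rewrite lev_vertex // (leq_trans (leq_pred _)) ?lev_le. Qed.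

Lemma pos_child s b : good s ->
  pos (child s b) = if lev s == 1 then b : nat else (pos s).*2 + b.
Proof.
case/andP => s0 gs; rewrite pos_vertex //; case: eqP => s1.
  by case: b; exact: leq_trans tree_size_gt4.
apply: leq_trans gs; case: (lev s) s0 s1 => [|[|l]] //= _ _.
rewrite expnS mulnA muln2 doubleS; apply: leq_trans (leq_pmulr _ _); last first.
  by rewrite expn_gt0.
by case: b; rewrite ?addn1 ?addn0.
Qed.

Lemma good_adj s b : good s -> tree_adj s (child s b).
Proof.
move=> gs; have /andP[s0 _] := gs; apply/orP; right; apply/andP; split.
  by rewrite lev_child prednK.
rewrite lev_child pos_child //; case: (lev s) s0 => [|[|l]] //= _.
  by case: b.
by rewrite addnC half_bit_double.
Qed.

Lemma good_lev s b : good s -> lev s = (lev (child s b)).+1.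
Proof. by case/andP => s0 _; rewrite lev_child prednK. Qed.

Lemma good_neq s : good s -> child s false != child s true.
Proof.
move=> gs; apply/eqP => /(congr1 pos); rewrite !pos_child //.
by case: ifP => _ //; lia.
Qed.

Lemma good_child s b : good s -> 2 <= lev s -> good (child s b).
Proof.
move=> gs l2; apply/andP; rewrite lev_child pos_child //.
have /andP[_] := gs; case: (lev s) l2 => [|[|l]] //= _ gl; split=> //.
apply: leq_trans gl; rewrite expnS mulnA leq_mul2r; apply/orP; right.
by case: b; lia.
Qed.

Lemma good_bot s t : good s -> good t -> lev s = 1 -> lev t = 1 -> child s =1 child t.
Proof. by move=> _ _ ls lt b; rewrite /child ls lt. Qed.

(** Positions 0, 2 and 4 have different halves, so no two corners share a parent. *)
Definition corner m (i : 'I_3) := vertex m i.*2.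
Definition corners m : pred tree_vertex := [pred s | s \in codom (corner m)].

Section Corners.
Variable m : nat.
Hypothesis hm : 2 <= m <= d.

Lemma corner_lt (i : 'I_3) : i.*2 < tree_size.
Proof. by apply: leq_trans tree_size_gt4; case: i => [] [|[|[|]]]. Qed.

Lemma lev_corner i : lev (corner m i) = m.
Proof. by rewrite lev_vertex //; case/andP: hm. Qed.

Lemma pos_corner i : pos (corner m i) = i.*2.
Proof. by rewrite pos_vertex // corner_lt. Qed.

Lemma corner_inj : injective (corner m).
Proof.
by move=> i j /(congr1 pos); rewrite !pos_corner => /double_inj; exact: val_inj.
Qed.

(** The largest position of a corner is 4, whence the factor 5 in [tree_size]; the power of two
    makes room for all descendants. *)
Lemma good_corner i : good (corner m i).
Proof.
rewrite /good lev_corner pos_corner; case/andP: hm => m2 md.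
rewrite (leq_trans _ m2) //= /tree_size leq_mul //; first by case: i => [] [|[|[|]]].
by rewrite leq_exp2l // (leq_trans (leq_pred _)).
Qed.

Lemma cornersP s : corners m s <-> exists i, s = corner m i.
Proof. by split=> [/codomP //|[i ->]]; exact: codom_f. Qed.

Lemma corners_lev s : corners m s -> lev s = m.
Proof. by move=> /cornersP [i ->]; exact: lev_corner. Qed.

Lemma corners_indep : indep tree_adj (corners m).
Proof.
by move=> s t /corners_lev sm /corners_lev tm; apply/negP => /tree_adj_lev; rewrite sm tm; lia.
Qed.

Lemma corners_common s t c : corners m s -> corners m t -> s != t ->
  tree_adj s c -> tree_adj t c -> False.
Proof.
move=> /cornersP [i ->] /cornersP [j ->] /eqP ij.
have {ij} : nat_of_ord i <> j by move=> /val_inj ij'; apply: ij; rewrite ij'.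
move=> ij /orP[] /up_pos + /orP[] /up_pos; rewrite !lev_corner !pos_corner ?doubleK.
all: case/andP: hm; lia.
Qed.

End Corners.

End Tree.

(** * Divergence bounds stated for words in the standard generators *)

Section Growth.
Variables (S : finType) (adj : rel S).
Local Notation G := (racg adj).
Local Notation elt := (elt adj).

Definition avoids (H : set G) r (g : G) (w : seq S) :=
  forall i h (x : seq S), i <= size w -> H h -> (h * elt x = g * elt (take i w))%g ->
    r <= size x.

(** [r] is at once the height of the ends above [H] and the avoided radius, while [n] is the
    separation factor of the divergence. *)
Definition filling_le (H : set G) m := forall n, exists C, forall r, 0 < r ->
  exists g w q1 q2 h1 h2, [/\ H h1, H h2, (h1 * elt q1 = g)%g,
    (h2 * elt q2 = g * elt w)%g &
    [/\ size q1 <= r, size q2 <= r, size w <= C * r ^ m,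
        forall x, elt x = elt w -> n * r <= size x & avoids H r g w]].

(** The displacement [n] along [H] supplies the last power of [r] once it is a large multiple of it.
    [D] is separate from [r] because [rho] and the change of generators affect the height of the
    ends and the avoided radius differently. *)
Definition filling_ge (H : set G) m := exists C, forall r D n g w q1 q2 h1 h2,
  H h1 -> H h2 -> (h1 * elt q1 = g)%g -> (h2 * elt q2 = g * elt w)%g ->
  size q1 <= D -> size q2 <= D -> (forall x, (h1 * elt x = h2)%g -> n <= size x) ->
  avoids H r g w -> (n - (2 * D + 3)) * r ^ m.-1 <= C * size w.

End Growth.

Lemma low_growth k : exists c, forall r, r ^ k <= c * maxn 1 (wall_cost k r).
Proof.
elim: k => [|k [c IH]]; first by exists 1.
exists (6 * 3 ^ k * c + 8 ^ k.+1) => r /=.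
(* From 8 on, [r./2 - 2] is at least a sixth of [r]; smaller radii are covered by the summand
   [8 ^ k.+1]. *)
have [r8|r8] := ltnP r 8.
  apply: leq_trans (leq_pmulr _ _); last by rewrite leq_max.
  by apply: leq_trans (leq_addl _ _); rewrite leq_exp2r // ltnW.
apply: (@leq_trans (6 * 3 ^ k * c * maxn 1 ((r./2 - 2) * maxn 1 (wall_cost k r./2)))); last first.
  by rewrite leq_mul2r leq_addr orbT.
apply: (@leq_trans (6 * 3 ^ k * c * ((r./2 - 2) * maxn 1 (wall_cost k r./2)))); last first.
  by rewrite leq_mul2l leq_maxr orbT.
have r2 : r <= 3 * r./2 by lia.
have r6 : r <= 6 * (r./2 - 2) by lia.
have h := IH r./2; rewrite expnS.
have h2 : r ^ k <= 3 ^ k * (c * maxn 1 (wall_cost k r./2)).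
  apply: (@leq_trans ((3 * r./2) ^ k)); first by case: (k) => [|k'] //; rewrite leq_exp2r.
  by rewrite expnMn leq_mul2l h orbT.
apply: leq_trans (leq_mul r6 h2) _.
move: (3 ^ k) (r./2 - 2) (maxn 1 _) => a b M; lia.
Qed.

Lemma upp_growth k : exists c, forall r, 0 < r -> ray_detour k r <= c * r ^ k.
Proof.
elim: k => [|k [c IH]]; first by exists 0.
exists (5 * c + 4) => r r0 /=; have := IH r r0.
have rk : 0 < r ^ k by rewrite expn_gt0 r0.
rewrite expnS; move: (r ^ k) rk (ray_detour k r) => M M0 U UM.
have h1 : r <= r * M by rewrite leq_pmulr.
have h2 : r * U <= c * (r * M) by rewrite (mulnC c) -mulnA leq_mul2l mulnC UM orbT.
have h3 : c * M <= c * (r * M) by rewrite leq_mul2l leq_pmull ?orbT.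
have h4 : U <= c * (r * M) by exact: leq_trans h3.
have -> : 2 * (r + (r * (U + 1) + U)) + U = 4 * r + 2 * (r * U) + 3 * U by lia.
have -> : (5 * c + 4) * (r * M) = 4 * (r * M) + 2 * (c * (r * M)) + 3 * (c * (r * M)) by lia.
by rewrite !leq_add // leq_mul2l.
Qed.

(** * Both word bounds for the subgroups of the corners *)

Section Tree.
Variables (d m : nat).
Hypothesis hm : 2 <= m <= d.
Local Notation adj := (@tree_adj d).
Local Notation sym := (@tree_adj_sym d).
Local Notation irr := (@tree_adj_irr d).
Local Notation adjlev := (@tree_adj_lev d).
Local Notation H := [set g | @inspan _ adj (@corners d m) g].

Lemma tree_filling_le : filling_le H m.
Proof.
move=> n; have [c cU] := upp_growth m.-1; exists (n * (c + 1) + c) => r r0.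
have m1 : m.-1.+1 = m by case/andP: hm; lia.
pose f (b : bool) := corner d m (inord b).
have f01 : f false != f true.
  by apply/eqP => /(@corner_inj d m) /(congr1 (@nat_of_ord 3)); rewrite !inordK.
have lE t : @corners d m t -> lev t = m.-1.+1 by move=> /(corners_lev hm) ->.
have fE b : @corners d m (f b) by exact: codom_f.
have fg b : good (f b) by exact: good_corner.
have [g [w [q1 [q2 [h1 [h2 [H1 H2 hg hw [s1 s2 sw far av]]]]]]]] :=
  upper_path adjlev (@good_adj d) (@good_lev d) (@good_neq d) (@good_child d)
    (@good_bot d) r (n * r) lE fE fg f01.
exists g, w, q1, q2, h1, h2; split=> //; split=> //; last first.
  by move=> i h x _; exact: av.
apply: leq_trans sw _; have := cU r r0.
have rk : 0 < r ^ m.-1 by rewrite expn_gt0 r0.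
have -> : r ^ m = r * r ^ m.-1 by rewrite -expnS m1.
move: (r ^ m.-1) rk (ray_detour _ r) => M M0 U UM.
have h1' : n * r <= n * (r * M) by rewrite leq_mul2l leq_pmulr ?orbT.
have h2' : n * r * U <= n * (c * (r * M)).
  by rewrite -mulnA leq_mul2l mulnCA leq_mul2l UM !orbT.
have h3 : U <= c * (r * M).
  by apply: leq_trans UM _; rewrite leq_mul2l leq_pmull ?orbT.
have -> : n * r * (U + 1) + U = n * r * U + n * r + U by lia.
have -> : (n * (c + 1) + c) * (r * M) = n * (c * (r * M)) + n * (r * M) + c * (r * M) by lia.
by rewrite !leq_add.
Qed.

Lemma tree_filling_ge : filling_ge H m.
Proof.
have [c cL] := low_growth m.-1; exists c => r D n g w q1 q2 h1 h2 H1 H2 hg hw s1 s2 far av.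
have [e re eh] : exists2 e, reducedin (@corners d m) e & elt adj e = (h1^-1 * h2)%g.
  by apply: inspanP; apply: inspanM => //; exact: inspanV.
have he : (h1 * elt adj e = h2)%g by rewrite eh mulVKg.
have lE s : @corners d m s -> m.-1 < lev s by move=> /(corners_lev hm) ->; case/andP: hm; lia.
rewrite -he in hw.
have lw : (size e - (2 * D + 3)) * maxn 1 (wall_cost m.-1 r) <= size w.
  apply: (low_bound_subgroup sym irr adjlev (@tree_common d) (@corners_indep d m hm) lE
    H1 re hg hw s1 s2) => i x y iw Ey; exact: av.
apply: (@leq_trans ((size e - (2 * D + 3)) * r ^ m.-1)).
  by rewrite leq_mul2r leq_sub2r ?orbT // far.
apply: (@leq_trans ((size e - (2 * D + 3)) * (c * maxn 1 (wall_cost m.-1 r)))).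
  by rewrite leq_mul2l cL orbT.
by rewrite mulnCA leq_mul2l lw orbT.
Qed.

End Tree.

Import GRing.Theory Num.Theory.
Import numFieldTopology.Exports numFieldNormedType.Exports.
Local Open Scope ring_scope.

(** * Curves in the realization of a graph *)

Section Realization.
Variables (R : realType) (V : cgraph).
Local Notation X := (realization R V).
Implicit Types (u v : V) (x y : X) (p : seq V).

Lemma mdistE x y : mdist x y = rdist x y.
Proof. by []. Qed.

Lemma realization_segment x : exists u v, on_segment u v x.
Proof. by case: x. Qed.

Section Extension.
Variable phi : V -> R.
Hypothesis phi_lip : forall u v, adjacent u v -> `|phi u - phi v| <= 1.

Lemma sum_delta u (s : seq V) : uniq s -> u \in s ->
  \sum_(w <- s) (w == u)%:R * phi w = phi u.
Proof.
move=> us uin; rewrite (bigD1_seq u) //= eqxx mul1r big1 ?addr0 // => w /negbTE ->.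
by rewrite mul0r.
Qed.

(** Affine extension of [phi] along edges, a 1-Lipschitz test function that bounds distances from
    below. [undup] prevents double counting on a degenerate segment. *)
Definition extension x : R :=
  let uP := cid (realization_segment x) in
  let u := proj1_sig uP in let v := proj1_sig (cid (proj2_sig uP)) in
  \sum_(w <- undup [:: u; v]) x w * phi w.

Lemma sum_segment u v t (s : seq V) : uniq s -> u \in s -> v \in s ->
  \sum_(w <- s) ((1 - t) * (w == u)%:R + t * (w == v)%:R) * phi w =
  (1 - t) * phi u + t * phi v.
Proof.
move=> us uin vin.
under eq_bigr do rewrite mulrDl -!mulrA.
by rewrite big_split /= -!mulr_sumr !sum_delta.
Qed.

Lemma extensionE u v t x : bary x = (fun w => (1 - t) * (w == u)%:R + t * (w == v)%:R) ->
  extension x = (1 - t) * phi u + t * phi v.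
Proof.
rewrite /extension => xE; case: cid => u' u'P; lazy zeta iota beta delta [proj1_sig proj2_sig].
case: cid => v' uv'; lazy iota beta delta [proj1_sig proj2_sig].
case: uv' => _ [t' [_ _ xE']].
(* A vertex lies on many segments; summing over the ends of both segments makes the two descriptions
   of [x] comparable. *)
pose s := undup [:: u; v; u'; v'].
have us : uniq s by exact: undup_uniq.
have -> : (1 - t) * phi u + t * phi v = (1 - t') * phi u' + t' * phi v'.
  rewrite -(@sum_segment u v t s) ?mem_undup ?inE ?eqxx ?orbT //.
  rewrite -(@sum_segment u' v' t' s) ?mem_undup ?inE ?eqxx ?orbT //.
  by apply: eq_bigr => w _; congr (_ * _); have := congr1 (@^~ w) xE'; rewrite xE.
rewrite xE'; apply: sum_segment;
  by rewrite ?undup_uniq ?mem_undup ?inE ?eqxx ?orbT.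
Qed.

Lemma extension_vtx v : extension (vtx R v) = phi v.
Proof.
rewrite (@extensionE v v 0); first by rewrite subr0 mul1r mul0r addr0.
by apply/funext => w /=; rewrite subr0 mul1r mul0r addr0.
Qed.

Lemma extension_step u v x y : on_segment u v x -> on_segment u v y ->
  `|extension x - extension y| <= `|x u - y u|.
Proof.
move=> [uv [t [t0 t1 xE]]] [_ [t' [t'0 t'1 yE]]].
rewrite (extensionE xE) (extensionE yE) xE yE eqxx !mulr1.
have [<- | nuv] := eqVneq u v.
  by rewrite -!mulrDl !subrK !mul1r !mulr1 !subrK !subrr normr0.
rewrite !mulr0 !addr0.
have -> : (1 - t) * phi u + t * phi v - ((1 - t') * phi u + t' * phi v) =
  ((1 - t) - (1 - t')) * (phi u - phi v) by ring.
rewrite normrM ler_piMr // phi_lip //.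
by case: uv => // uv; rewrite uv eqxx in nuv.
Qed.

Lemma extension_lip x y : `|extension x - extension y| <= rdist x y.
Proof.
apply: le_rdist => l; elim=> [z|u v {}x {}y z {}l xuv yuv _ IH].
  by rewrite subrr normr0.
rewrite (le_trans (ler_distD (extension y) _ _)) // lerD //.
exact: extension_step xuv yuv.
Qed.

Lemma rdist_vtx_ge u v : phi v - phi u <= rdist (vtx R u) (vtx R v).
Proof.
rewrite -(extension_vtx u) -(extension_vtx v) rdist_sym.
exact: le_trans (ler_norm _) (extension_lip _ _).
Qed.

End Extension.

Lemma near_vtx x : exists u, rdist x (vtx R u) <= 1.
Proof.
have [u [v xuv]] := realization_segment x; exists u.
have uuv : on_segment u v (vtx R u) by apply: on_segment_vtx; case: xuv.
have := rdist_le (string_cons xuv uuv (string_nil _)); rewrite addr0 => /le_trans; apply.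
case: xuv => _ [t [t0 t1 ->]] /=; rewrite eqxx mulr1.
by case: eqP => _; rewrite /= ?mulr1n ?mulr1 ?mulr0 ?addr0 ler_norml; apply/andP; split; lra.
Qed.

Definition lazy u v := u = v \/ adjacent u v.

Fixpoint lazy_path u p : Prop :=
  if p is v :: p' then lazy u v /\ lazy_path v p' else True.

Lemma lazy_path_cat u p q : lazy_path u (p ++ q) <-> lazy_path u p /\ lazy_path (last u p) q.
Proof.
elim: p u => [|v p IH] u /=; first by split=> // -[].
by split=> [[uv /IH [pp pq]]|[[uv pp] pq]]; do !split=> //; apply/IH.
Qed.

Lemma lazy_sym u v : lazy u v -> lazy v u.
Proof. by case=> [->|/adjacent_sym]; [left|right]. Qed.

Lemma lazy_path_rev u p : lazy_path u p ->
  exists q, [/\ lazy_path (last u p) q, last (last u p) q = u & size q = size p].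
Proof.
elim: p u => [|v p IH] u /=; first by exists [::].
move=> [uv /IH [q [pq lq sq]]]; exists (q ++ [:: u]); split.
- by apply/lazy_path_cat; split=> //; rewrite lq; split=> //; exact: lazy_sym.
- by rewrite last_cat.
- by rewrite size_cat addn1 sq.
Qed.

Fact point_subproof u v (t : R) : exists x, lazy u v -> 0 <= t <= 1 ->
  bary x = (fun w => (1 - t) * (w == u)%:R + t * (w == v)%:R).
Proof.
have [uv|] := pselect (lazy u v); last by exists (vtx R u).
have [/andP[t0 t1]|] := boolP (0 <= t <= 1); last by exists (vtx R u).
have P : exists u v, on_segment u v (fun w : V => (1 - t) * (w == u)%:R + t * (w == v)%:R).
  by exists u, v; split=> //; exists t.
have P' : exists u' v', on_segment u' v' (fun w : V => (1 - t) * (w == u)%:R + t * (w == v)%:R).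
  by exists u, v; split=> //; exists t.
by exists (Realization P').
Qed.

Definition point u v t : X := proj1_sig (cid (point_subproof u v t)).

Lemma pointE u v t : lazy u v -> 0 <= t <= 1 ->
  bary (point u v t) = (fun w => (1 - t) * (w == u)%:R + t * (w == v)%:R).
Proof. by rewrite /point; case: cid. Qed.

Lemma point_segment u v t : lazy u v -> 0 <= t <= 1 -> on_segment u v (point u v t).
Proof.
by move=> uv t01; split=> //; exists t; rewrite pointE //; case/andP: t01.
Qed.

Lemma point0 u v : lazy u v -> point u v 0 = vtx R u.
Proof.
move=> uv; apply: bary_inj; rewrite pointE ?lexx ?ler01 //.
by apply/funext => w /=; rewrite subr0 mul1r mul0r addr0.
Qed.

Lemma point1 u v : lazy u v -> point u v 1 = vtx R v.
Proof.
move=> uv; apply: bary_inj; rewrite pointE ?lexx ?ler01 //.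
by apply/funext => w /=; rewrite subrr mul0r mul1r add0r.
Qed.

Lemma rdist_point u v s t : lazy u v -> 0 <= s -> s <= t -> t <= 1 ->
  rdist (point u v s) (point u v t) <= t - s.
Proof.
move=> uv s0 st t1.
have s01 : 0 <= s <= 1 by rewrite s0 (le_trans st).
have t01 : 0 <= t <= 1 by rewrite t1 (le_trans s0).
have := rdist_le (string_cons (point_segment uv s01) (point_segment uv t01) (string_nil _)).
rewrite addr0 => /le_trans; apply; rewrite !pointE // eqxx.
case: eqP => _; rewrite ?mulr1 ?mulr0 ?addr0.
  by rewrite !subrK subrr normr0 subr_ge0.
by rewrite ler_norml; apply/andP; split; lra.
Qed.

Fixpoint wcurve u p (s : R) : X :=
  if p is v :: p' then if s <= 1 then point u v s else wcurve v p' (s - 1) else vtx R u.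

Lemma wcurve0 u p : lazy_path u p -> wcurve u p 0 = vtx R u.
Proof. by case: p => //= v p [uv _]; rewrite ler01 point0. Qed.

Lemma wcurve_lip u p s t : lazy_path u p -> 0 <= s -> s <= t -> t <= (size p)%:R ->
  rdist (wcurve u p s) (wcurve u p t) <= t - s.
Proof.
elim: p u s t => [|v p IH] u s t /=.
  by move=> _ s0 st t0; rewrite rdistxx subr_ge0.
move=> [uv pp] s0 st; rewrite -addn1 natrD => tp.
have [t1|t1] := leP t 1; first by rewrite (le_trans st t1); exact: rdist_point.
have tp' : t - 1 <= (size p)%:R by lra.
have [s1|s1] := leP s 1; last first.
  by apply: le_trans (IH v (s - 1) (t - 1) pp _ _ tp') _; lra.
apply: le_trans (rdist_triangle (vtx R v) _ _) _.
have h1 : rdist (point u v s) (vtx R v) <= 1 - s by rewrite -(point1 uv); exact: rdist_point.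
have h2 : rdist (vtx R v) (wcurve v p (t - 1)) <= t - 1 - 0.
  by rewrite -(wcurve0 pp); apply: IH => //; lra.
lra.
Qed.

Lemma wcurve_cat u p q s : lazy_path u p -> lazy_path (last u p) q -> 0 <= s ->
  wcurve u (p ++ q) s = if s <= (size p)%:R then wcurve u p s
                        else wcurve (last u p) q (s - (size p)%:R).
Proof.
elim: p u s => [|v p IH] u s /=.
  move=> _ pq s0; rewrite subr0; case: leP => // s0'.
  have -> : s = 0 by lra.
  exact: wcurve0.
move=> [uv pp] pq s0; rewrite -addn1 natrD; case: (leP s 1) => s1.
  by rewrite ler_wpDl.
rewrite IH //; last by lra.
rewrite lerBlDr; case: leP => // _; congr wcurve; lra.
Qed.

Lemma wcurve_end u p : lazy_path u p -> wcurve u p (size p)%:R = vtx R (last u p).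
Proof.
elim: p u => //= v p IH u [uv pp]; rewrite -addn1 natrD addrK IH //.
case: leP => // p1; have -> : (size p)%:R + 1 = 1 :> R by have := ler0n R (size p); lra.
have p0 : (size p <= 0)%N by rewrite -(ler_nat R); lra.
by rewrite point1 //; case: p p0 {IH pp p1}.
Qed.

End Realization.

(** * Lengths of Lipschitz curves *)

Section Curves.
Variables (R : realType) (X : metricType R).
Implicit Types (c : R -> X) (C : set X).

(** Extends a curve by constants beyond the unit interval, so that continuity can be proved on the
    whole line. *)
Definition clamp (t : R) : R := if t <= 0 then 0 else if t <= 1 then t else 1.

Lemma clamp_ge0 t : 0 <= clamp t.
Proof.
by rewrite /clamp; case: (leP t 0) => // t0; case: (leP t 1) => _; rewrite ?ler01 // ltW.
Qed.

Lemma clamp_le1 t : clamp t <= 1.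
Proof. by rewrite /clamp; case: (leP t 0) => _; rewrite ?ler01 //; case: (leP t 1). Qed.

Lemma clamp_id t : 0 <= t <= 1 -> clamp t = t.
Proof. by rewrite /clamp => /andP[t0 ->]; case: leP => // t0'; apply/le_anti/andP. Qed.

Lemma clamp_mono s t : s <= t -> clamp s <= clamp t /\ clamp t - clamp s <= t - s.
Proof.
rewrite /clamp => st.
case: (leP s 0) => s0; case: (leP t 0) => t0; try (by split; lra);
  case: (leP t 1) => t1; try (by split; lra); case: (leP s 1) => s1; by split; lra.
Qed.

Lemma lip_length_dist (gam : R -> X) (a b : R) C : a <= b ->
  (forall s t, a <= s -> s <= t -> t <= b -> mdist (gam s) (gam t) <= t - s) ->
  (forall s, a <= s <= b -> C (gam s)) ->
  (length_dist C (gam a) (gam b) <= (b - a)%:E)%E.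
Proof.
move=> ab lip inC.
pose c t := gam (a + clamp t * (b - a)).
have cl0 : clamp 0 = 0 by rewrite clamp_id // lexx ler01.
have cl1 : clamp 1 = 1 by rewrite clamp_id // lexx ler01.
have range t : a <= a + clamp t * (b - a) <= b.
  have := clamp_ge0 t; have := clamp_le1 t => h1 h0.
  have ab' : 0 <= b - a by lra.
  have := mulr_ge0 h0 ab'; have := ler_wpM2r ab' h1; lra.
have clip s t : s <= t -> mdist (c s) (c t) <= (t - s) * (b - a).
  move=> st; have [m1 m2] := clamp_mono st.
  have ab' : 0 <= b - a by lra.
  have /andP[rs1 _] := range s; have /andP[_ rt2] := range t.
  have := ler_wpM2r ab' m1 => h1; have := ler_wpM2r ab' m2 => h2.
  apply: (le_trans (lip _ _ _ _ _)) => //; first lra.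
  by apply: le_trans h2; rewrite mulrBl; lra.
apply: (@le_trans _ _ (curve_length c)).
  apply: ereal_inf_lbound; exists c => //; split.
  - apply: continuous_subspaceT => t.
    apply/metricType_numDomainType.cvgrPdist_lt => e e0.
    (* The added 1 covers the case [a = b]. *)
    have b0 : 0 < b - a + 1 by lra.
    have e'0 : 0 < e / (b - a + 1) by exact: divr_gt0.
    near=> s.
    have : `|t - s| * (b - a) < e.
      have : `|t - s| < e / (b - a + 1).
        by near: s; exact: (@cvgr_dist_lt _ _ _ _ _ id t _ _ e'0).
      rewrite ltr_pdivlMr // => /(le_lt_trans _); apply.
      by rewrite ler_wpM2l //; lra.
    apply: le_lt_trans.
    case: (leP t s) => ts; first by rewrite distrC ger0_norm ?subr_ge0 //; exact: clip.
    by rewrite metric_sym ger0_norm ?subr_ge0 ?(ltW ts) //; apply/clip/ltW.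
  - by rewrite /c cl0 mul0r addr0.
  - by rewrite /c cl1 mul1r addrC subrK.
  - by move=> t _; exact: inC.
apply: ge_ereal_sup => _ [s [ps /eqP ls] <-]; rewrite lee_fin.
apply: (@le_trans _ _ (\sum_(0 <= i < size s) (nth 1 (0 :: s) i.+1 - nth 1 (0 :: s) i) * (b - a))).
  rewrite !big_nat; apply: ler_sum => i /andP[_ si]; apply: clip; apply: ltW.
  by have /(pathP 1) := ps; exact.
rewrite -mulr_suml telescope_sumr // [nth _ _ 0]/= subr0.
have -> : nth 1 (0 :: s) (size s) = 1 by rewrite nth_last /= ls.
by rewrite mul1r.
Unshelve. all: by end_near.
Qed.

Lemma length_dist_sub C C' x y : C `<=` C' -> (length_dist C' x y <= length_dist C x y)%E.
Proof.
move=> CC'; apply: ereal_inf_le_tmp => _ [c [cc c0 c1 cC] <-]; exists c => //.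
by split=> // t /cC /CC'.
Qed.

End Curves.

(** * Cutting a rectifiable curve into short steps *)

Section Chains.
Variables (R : realType) (X : metricType R).
Implicit Types (c : R -> X) (C : set X).

Lemma mdist_continuous (x : X) : continuous (fun y => mdist x y : R).
Proof.
move=> y; apply/cvgrPdist_lt => e e0; near=> z.
have yz : mdist y z < e.
  by near: z; exact: (@metricType_numDomainType.cvgr_dist_lt _ _ _ _ _ id y _ e e0).
have h1 := metric_triangle x y z; have h2 := metric_triangle x z y.
rewrite (metric_sym z y) in h2.
by rewrite ltr_norml; apply/andP; split; lra.
Unshelve. all: by end_near.
Qed.

Lemma mdist_curve_continuous c a : 0 <= a -> {within `[0, 1], continuous c} ->
  {within `[a, 1], continuous (fun t => mdist (c a) (c t) : R)}.
Proof.
move=> a0 cc.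
have ca : {within `[a, 1], continuous c}.
  apply: continuous_subspaceW cc => t /=; rewrite !in_itv /= => /andP[at_ ->].
  by rewrite (le_trans a0).
move=> t; apply: (@continuous_comp (subspace `[a, 1]) _ _ c); first exact: ca.
exact: mdist_continuous.
Qed.

Definition unit_step c a b := (a < b) && (mdist (c a) (c b) == 1).

Lemma unit_step_length c s : path (unit_step c) 0 s -> last 0 s < 1 ->
  ((size s)%:R%:E <= curve_length c)%E.
Proof.
move=> ps ls; have pl : path <%R 0 (rcons s 1).
  by rewrite rcons_path ls andbT; apply: sub_path ps => a b /andP[].
apply: le_trans (ereal_sup_ubound _); last first.
  by exists (rcons s 1) => //; split=> //; rewrite last_rcons.
rewrite lee_fin size_rcons big_nat_recr //= ler_wpDr ?mdist_ge0 //.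
have -> : (size s)%:R = \sum_(0 <= i < size s) 1 :> R by rewrite sumr_const_nat subn0.
rewrite !big_nat; apply: ler_sum => i /andP[_ si].
have /(pathP 1) /(_ i si) /andP[_ /eqP m1] := ps.
by rewrite -rcons_cons !nth_rcons si /= ltnS (ltnW si) m1.
Qed.

Lemma unit_step_range c s t : path (unit_step c) t s -> 0 <= t -> last t s < 1 ->
  all (fun t => 0 <= t <= 1) s.
Proof.
elim: s t => //= u s IH t /andP[/andP[tu _] ps] t0 ls.
have u0 : 0 <= u by rewrite (le_trans t0) // ltW.
rewrite u0 (IH u) //= andbT.
have : path <=%R u s by apply: sub_path ps => a b /andP[/ltW].
elim: (s) (u) ls => [|v r IHr] w /=; first by move/ltW.
move=> lr /andP[wv pr]; exact: le_trans (IHr _ lr pr).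
Qed.

(** While the end of the curve is more than 1 away, the intermediate value theorem gives a later
    time at distance exactly 1; otherwise the subdivision stops. *)
Lemma unit_step_extend c n : {within `[0, 1], continuous c} ->
  (exists s, [/\ size s = n, path (unit_step c) 0 s & last 0 s < 1]) \/
  (exists s, [/\ (size s <= n)%N, path (unit_step c) 0 s, last 0 s < 1 &
     mdist (c (last 0 s)) (c 1) <= 1]).
Proof.
move=> cc; elim: n => [|n [[s [ss ps ls]]|[s [ss ps ls ms]]]].
- by left; exists [::]; split=> //=; exact: ltr01.
- have [ms|ms] := leP (mdist (c (last 0 s)) (c 1)) 1.
    by right; exists s; split=> //; rewrite ss.
  have a0 : 0 <= last 0 s.
    have := unit_step_range ps (lexx _) ls.
    by case/lastP: (s) => //= r z; rewrite all_rcons last_rcons => /andP[/andP[]].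
  have [|t] := IVT (ltW ls) (mdist_curve_continuous a0 cc) (v := 1).
    by rewrite mdistxx ge_min ler01 /= le_max (ltW ms) orbT.
  rewrite in_itv /= => /andP[at_ t1] mt; left; exists (rcons s t); split.
  + by rewrite size_rcons ss.
  + rewrite rcons_path ps /unit_step mt eqxx andbT lt_neqAle at_ andbT.
    apply/eqP => tE; move: mt; rewrite -tE mdistxx => /eqP.
    by rewrite eq_sym oner_eq0.
  + rewrite last_rcons lt_neqAle t1 andbT; apply/eqP => tE.
    by move: ms; rewrite tE in mt; rewrite mt ltxx.
- by right; exists s; split=> //; exact: leqW.
Qed.

(** Each unit step uses up length 1, so the greedy subdivision stops after at most [l] of them; the
    last short step accounts for the extra 1. *)
Lemma curve_chain c (l : R) : {within `[0, 1], continuous c} ->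
  (curve_length c <= l%:E)%E ->
  exists s, [/\ last 0 s = 1, path (fun a b => mdist (c a) (c b) <= 1) 0 s,
    all (fun t => 0 <= t <= 1) s & (size s)%:R <= l + 1].
Proof.
move=> cc cl.
have bound s : path (unit_step c) 0 s -> last 0 s < 1 -> (size s)%:R <= l.
  by move=> ps ls; rewrite -lee_fin; apply: le_trans (unit_step_length ps ls) cl.
have l0 : 0 <= l by apply: (bound [::]) => //=; exact: ltr01.
have [[s [ss ps ls]]|[s [ss ps ls ms]]] := unit_step_extend (Num.trunc l).+1 cc.
  have := bound s ps ls; rewrite ss; have /andP[_] := truncn_itv l0.
  by move=> h1 h2; have := lt_le_trans h1 h2; rewrite ltxx.
exists (rcons s 1); split.
- by rewrite last_rcons.
- rewrite rcons_path ms andbT; apply: sub_path ps => a b /andP[_ /eqP ->]; exact: lexx.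
- by rewrite all_rcons ler01 lexx (unit_step_range ps (lexx _) ls).
- by rewrite size_rcons -addn1 natrD lerD2r bound.
Qed.

End Chains.

(** * Cayley graphs of arbitrary finite generating sets *)

Section SetDistance.
Variables (R : realType) (X : metricType R).
Implicit Types (A : set X) (x y a : X) (r : R).

Lemma edistE x y : edist (x, y) = (mdist x y)%:E.
Proof.
apply/le_anti/andP; split.
  apply/lee_addgt0Pr => e e0; rewrite -EFinD; apply: edist_fin => /=.
    by have := mdist_ge0 x y; lra.
  by rewrite ballEmdist /= ltrDl.
apply: le_ereal_inf_tmp => _ [r /= [r0 xy] <-]; rewrite lee_fin ltW //.
by move: xy; rewrite ballEmdist.
Qed.

Lemma edist_inf_ge A x r : (forall a, A a -> r <= mdist x a) -> (r%:E <= edist_inf A x)%E.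
Proof.
by move=> h; apply: le_ereal_inf_tmp => _ [a Aa <-]; rewrite edistE lee_fin h.
Qed.

Lemma edist_inf_le A x a : A a -> (edist_inf A x <= (mdist x a)%:E)%E.
Proof. by move=> Aa; apply: ereal_inf_lbound; exists a; rewrite ?edistE. Qed.

Lemma co_nbhd_mdist A r x a : co_nbhd r A x -> A a -> r <= mdist x a.
Proof.
move=> /negP; rewrite -leNgt => h Aa; rewrite -lee_fin.
exact: le_trans h (edist_inf_le x Aa).
Qed.

Lemma mdist_co_nbhd A r x : (forall a, A a -> r <= mdist x a) -> co_nbhd r A x.
Proof. by move=> h; apply/negP; rewrite -leNgt; exact: edist_inf_ge. Qed.

Lemma bd_nbhd_near A r x : bd_nbhd r A x -> exists2 a, A a & mdist x a < r + 1.
Proof.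
rewrite /bd_nbhd /= => xr.
have : (edist_inf A x < (r + 1)%:E)%E by rewrite xr lte_fin ltrDl.
by move=> /ereal_inf_lt [_ [a Aa <-]]; rewrite edistE lte_fin; exists a.
Qed.

End SetDistance.

(** * Comparison of word length with Cayley distance *)

Section Transfer.
Variables (R : realType) (S : finType) (adj : rel S).
Local Notation G := (racg adj).
Local Notation elt := (elt adj).
Variables (T : set G) (genT : generates T).
Hypothesis finT : finite_set T.
Local Notation V := (cayley genT).
Local Notation X := (realization R V).
Implicit Types (g h : G) (x w : seq S).

Definition cayley_vtx g : X := vtx R (g : V).

Lemma shortest g : exists x, elt x = g /\ forall y : seq S, elt y = g -> (size x <= size y)%N.
Proof.
have [w wg] := elt_surj g.
have ex : exists n, `[< exists x, elt x = g /\ size x = n >].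
  by exists (size w); apply/asboolP; exists w.
case: (ex_minnP ex) => n /asboolP [x [xg <-]] xmin; exists x; split=> // y yg.
by apply: xmin; apply/asboolP; exists y.
Qed.

(** Length in the vertices of the defining graph, not in [T]. *)
Definition wlen g := size (proj1_sig (cid (shortest g))).

Lemma wlen_word g : exists x, elt x = g /\ size x = wlen g.
Proof. by rewrite /wlen; case: cid => x [xg _] /=; exists x. Qed.

Lemma wlen_le x g : elt x = g -> (wlen g <= size x)%N.
Proof. by rewrite /wlen; case: cid => y [_ h] /= /h. Qed.

Lemma wlenM g h : (wlen (g * h)%g <= wlen g + wlen h)%N.
Proof.
have [x [xg <-]] := wlen_word g; have [y [yh <-]] := wlen_word h.
by rewrite -size_cat; apply: wlen_le; rewrite elt_cat xg yh.
Qed.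

Lemma wlenV g : (wlen (g^-1)%g = wlen g)%N.
Proof.
have h g' : (wlen (g'^-1)%g <= wlen g')%N.
  have [x [xg <-]] := wlen_word g'.
  by rewrite -(size_rev x); apply: wlen_le; rewrite elt_rev xg.
by apply/eqP; rewrite eqn_leq h -{1}(invgK g) h.
Qed.

Lemma walk_lazy_path (u v : V) : walk (@adjacent V) u v ->
  exists p, lazy_path u p /\ last u p = v.
Proof.
elim=> [{}u|{}u w {}v uw _ [p [pp lp]]]; first by exists [::].
by exists (w :: p); split=> //; split=> //; right.
Qed.

Lemma lazy_path_mull (a : G) (u : V) p : lazy_path u p ->
  lazy_path ((a * u)%g : V) [seq (a * (v : G))%g : V | v <- p].
Proof.
elim: p u => //= v p IH u [uv /IH pp]; split=> //.
case: uv => [->|[uv [s Ts us]]]; first by left.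
right; split; first by move/mulgI.
by exists s => //; case: us => ->; rewrite mulgA; [left|right].
Qed.

(** Both generating sets are finite, so maxima exist; left translation carries the paths chosen at
    the identity to every [g]. *)
Lemma transfer_constant : exists K : nat, [/\ (0 < K)%N,
  forall t, T t -> (wlen t <= K)%N &
  forall s g, exists p, [/\ lazy_path (g : V) p, last (g : V) p = (g * elt [:: s])%g &
    (size p <= K)%N]].
Proof.
have /finite_seqP [ts tsE] := finT.
have ex s : exists p, lazy_path (1%g : V) p /\ last (1%g : V) p = elt [:: s].
  by apply: walk_lazy_path; exact: cgraph_connected.
pose P s := proj1_sig (cid (ex s)).
exists (\max_(t <- ts) wlen t + \max_(s : S) size (P s) + 1)%N; split.
- by rewrite addn1.
- move=> t Tt; have tin : t \in ts by move: Tt; rewrite tsE.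
  rewrite -addnA; apply: leq_trans (leq_addr _ _).
  exact: leq_bigmax_seq.
- move=> s g; exists [seq (g * (v : G))%g : V | v <- P s].
  have Ps : (size (P s) <= \max_(s : S) size (P s))%N.
    exact: (leq_bigmax (F := fun s : S => size (P s))).
  have [pp lp] : lazy_path (1%g : V) (P s) /\ last (1%g : V) (P s) = elt [:: s].
    by rewrite /P; case: (cid (ex s)).
  split.
  + by have := lazy_path_mull g pp; rewrite mulg1.
  + by rewrite -{1}(mulg1 g) -lp last_map.
  + by rewrite size_map addn1 ltnW // ltnS; apply: leq_trans Ps (leq_addl _ _).
Qed.

Variable K : nat.
Hypothesis K0 : (0 < K)%N.
Hypothesis KT : forall t, T t -> (wlen t <= K)%N.
Hypothesis KS : forall s g, exists p, [/\ lazy_path (g : V) p,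
  last (g : V) p = (g * elt [:: s])%g & (size p <= K)%N].

(** Word length from [g] divided by [K] changes by at most 1 along an edge, so [rdist_vtx_ge]
    applies to it. *)
Lemma rdist_word_ge g h : exists x, (g * elt x)%g = h /\
  (size x)%:R <= K%:R * mdist (cayley_vtx g) (cayley_vtx h).
Proof.
have [x [xg xl]] := wlen_word (g^-1 * h)%g; exists x; split; first by rewrite xg mulVKg.
rewrite xl mdistE.
pose phi (v : V) : R := (wlen (g^-1 * (v : G))%g)%:R / K%:R.
have Kp : 0 < K%:R :> R by rewrite ltr0n.
have lip (u v : V) : adjacent u v -> `|phi u - phi v| <= 1.
  move=> [_ [t Tt uv]].
  rewrite /phi -mulrBl normrM [`|K%:R^-1|]gtr0_norm ?invr_gt0 // ler_pdivrMr // mul1r.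
  have h1 : (wlen (g^-1 * (u : G))%g <= wlen (g^-1 * (v : G))%g + K)%N.
    case: uv => uv; last by rewrite uv mulgA (leq_trans (wlenM _ _)) // leq_add2l KT.
    have -> : (u : G) = (v * t^-1)%g by rewrite uv mulgK.
    by rewrite mulgA (leq_trans (wlenM _ _)) // leq_add2l wlenV KT.
  have h2 : (wlen (g^-1 * (v : G))%g <= wlen (g^-1 * (u : G))%g + K)%N.
    case: uv => uv; first by rewrite uv mulgA (leq_trans (wlenM _ _)) // leq_add2l KT.
    have -> : (v : G) = (u * t^-1)%g by rewrite uv mulgK.
    by rewrite mulgA (leq_trans (wlenM _ _)) // leq_add2l wlenV KT.
  rewrite -!(ler_nat R) !natrD in h1 h2.
  by rewrite ler_norml; apply/andP; split; lra.
have := rdist_vtx_ge lip (g : V) (h : V).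
rewrite /phi mulVg.
have -> : (wlen 1%g = 0)%N by apply/eqP; rewrite -leqn0 -[0%N]/(size (@nil S)); exact: wlen_le.
by rewrite mul0r subr0 ler_pdivrMr // mulrC.
Qed.

Lemma word_path w g : exists p, [/\ lazy_path (g : V) p, last (g : V) p = (g * elt w)%g,
  (size p <= K * size w)%N &
  forall s : R, 0 <= s -> s <= (size p)%:R ->
    exists2 j, (j <= size w)%N &
      mdist (wcurve (g : V) p s) (cayley_vtx (g * elt (take j w))%g) <= K%:R].
Proof.
elim: w g => [|a w IH] g.
  exists [::]; split; rewrite ?mulg1 ?muln0 // => s s0 s1; exists 0%N => //=.
  by rewrite mulg1 mdistxx ler0n.
have [p [pp lp sp]] := KS a g; have [q [pq lq sq near_]] := IH (g * elt [:: a])%g.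
have pq' : lazy_path (last (g : V) p) q by rewrite lp.
exists (p ++ q); split.
- by apply/lazy_path_cat.
- by rewrite last_cat lp lq (elt_cons adj a w) mulgA.
- by rewrite size_cat /= mulnS leq_add.
- move=> s s0; rewrite size_cat natrD => s1; rewrite wcurve_cat //.
  case: leP => sl.
    exists 0%N => //; rewrite take0 mulg1.
    rewrite mdistE rdist_sym /cayley_vtx -(wcurve0 R pp).
    have := wcurve_lip pp (lexx 0) s0 sl; have : (size p)%:R <= K%:R :> R by rewrite ler_nat.
    by rewrite subr0 => h1 h2; apply: le_trans h2 _; exact: le_trans h1.
  have [||j jw jn] := near_ (s - (size p)%:R); [lra|lra|].
  exists j.+1 => //=; rewrite (elt_cons adj a) mulgA.
  by move: jn; rewrite lp.
Qed.

Lemma mdist_path_le (u v : V) p : lazy_path u p -> last u p = v ->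
  mdist (vtx R u) (vtx R v) <= (size p)%:R.
Proof.
move=> pp <-; rewrite mdistE -(wcurve_end R pp) -{1}(wcurve0 R pp).
by have := wcurve_lip pp (lexx 0) (ler0n R (size p)) (lexx _); rewrite subr0.
Qed.

Lemma mdist_word_le g x : mdist (cayley_vtx g) (cayley_vtx (g * elt x)%g) <= K%:R * (size x)%:R.
Proof.
have [p [pp lp sp _]] := word_path x g.
by apply: le_trans (mdist_path_le pp lp) _; rewrite -natrM ler_nat.
Qed.

End Transfer.

Section WalkCurve.
Variables (R : realType) (V : cgraph).

Lemma wcurve_mid (u : V) p q r (s : R) : lazy_path u (p ++ q ++ r) ->
  0 <= s -> s <= (size q)%:R ->
  wcurve u (p ++ q ++ r) ((size p)%:R + s) = wcurve (last u p) q s.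
Proof.
move=> pqr s0 sq; have [pp qr] := (lazy_path_cat _ _ _).1 pqr.
have [pq pr] := (lazy_path_cat _ _ _).1 qr.
rewrite wcurve_cat //; last by rewrite addr_ge0.
case: leP => sp.
  have -> : s = 0 by lra.
  by rewrite addr0 wcurve_end // wcurve0.
rewrite addrC addKr wcurve_cat //.
by rewrite sq.
Qed.

End WalkCurve.

(** * Upper bound for the divergence *)

Section Upper.
Variables (R : realType) (S : finType) (adj : rel S).
Local Notation G := (racg adj).
Local Notation elt := (elt adj).
Variables (T : set G) (genT : generates T).
Local Notation V := (cayley genT).
Local Notation X := (realization R V).
Local Notation cayley_vtx := (cayley_vtx R genT).
Variable H : set G.
Hypothesis H1 : H 1%g.
Implicit Types (g h : G).

Definition subgroup_vtx : set X := [set vtx R (h : V) | h in H].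

(** The number of edges to [H] is 1-Lipschitz on vertices and vanishes on [H], so its extension
    shows that a shortest edge path realizes the distance. *)
Lemma nearest_path (g : G) : exists p, [/\ lazy_path (g : V) p, H (last (g : V) p) &
  forall h, H h -> (size p)%:R <= mdist (cayley_vtx g) (cayley_vtx h)].
Proof.
have ex (u : V) : exists n, `[< exists p, [/\ lazy_path u p, H (last u p) & size p = n] >].
  have [p [pp lp]] := walk_lazy_path (cgraph_connected u (1%g : V)).
  by exists (size p); apply/asboolP; exists p; rewrite lp.
pose dH u := ex_minn (ex u).
have dHP (u : V) : exists p : seq V, [/\ lazy_path u p, H (last u p) & size p = dH u].
  by rewrite /dH; case: ex_minnP => n /asboolP.
have dHle (u : V) (p : seq V) : lazy_path u p -> H (last u p) -> (dH u <= size p)%N.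
  by move=> pp Hp; rewrite /dH; case: ex_minnP => n _; apply; apply/asboolP; exists p.
have dH1 (u v : V) : adjacent u v -> (dH u <= (dH v).+1)%N.
  move=> uv; have [p [pp Hp <-]] := dHP v; apply: (dHle u (v :: p)) => //.
  by split=> //; right.
pose phi (u : V) : R := (dH u)%:R.
have lip (u v : V) : adjacent u v -> `|phi u - phi v| <= 1.
  move=> uv; have := dH1 _ _ uv; have := dH1 _ _ (adjacent_sym uv).
  rewrite -!(ler_nat R) -!natr1 -/(phi u) -/(phi v) => h1 h2.
  by rewrite ler_norml; apply/andP; split; lra.
have [p [pp Hp sp]] := dHP (g : V); exists p; split=> // h Hh; rewrite sp.
rewrite metric_sym mdistE; apply: le_trans (rdist_vtx_ge lip (h : V) (g : V)).
have -> : phi (h : V) = 0; last by rewrite subr0.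
by apply/eqP; rewrite pnatr_eq0 -leqn0; exact: (dHle (h : V) [::]).
Qed.

Variable K : nat.
Hypothesis K0 : (0 < K)%N.
Hypothesis KT : forall t, T t -> (wlen t <= K)%N.
Hypothesis KS : forall s g, exists p, [/\ lazy_path (g : V) p,
  last (g : V) p = (g * elt [:: s])%g & (size p <= K)%N].

(** The curve runs from [H] to the start of [w] by a shortest path, along [w], and back to [H] by a
    shortest path. On the outer parts the distance to [H] changes at unit speed, so cutting off time
    [r] at both ends leaves endpoints on the boundary. *)
Lemma divergence_le m n : (0 < m)%N -> filling_le H m ->
  exists2 C : R, 0 < C & forall r rho, 1 <= r -> 0 < rho -> rho <= 1 ->
    (divergence subgroup_vtx n rho r <= (C * r ^+ m)%:E)%E.
Proof.
(* The outer factor [K] turns word length into distance; [2 * K] pays for the two outer parts, of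
   length at most [K * k] each. *)
move=> m0 /(_ (K * (n + 2 * K))%N) [C0 fill].
(* Chosen so that [k] below is at most [B * r] for [r >= 1]. *)
pose B : nat := (K * (K + 2))%N.
pose C : nat := (2 * K * B + K * C0 * B ^ m + 1)%N.
have CE : C%:R = 2 * (K%:R * B%:R) + K%:R * (C0%:R * B%:R ^+ m) + 1 :> R.
  by rewrite /C; move: (B) => B'; rewrite !natrD !natrM natrX; ring.
exists C%:R; first by rewrite ltr0n /C addn1.
move=> r rho r1 rho0 rho1.
have r0 : 0 <= r by lra.
pose ri := (Num.trunc r).+1.
have /andP[tr1 tr2] := truncn_itv r0.
have rri : r < ri%:R by [].
have ri1 : ri%:R <= r + 1 by rewrite /ri -natr1; lra.
(* Word distance [k] means distance at least [K + ri], and the curve along [w] strays at most [K]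
   from the vertices of [w]. *)
pose k := (K * (K + ri))%N.
have k0 : (0 < k)%N by rewrite muln_gt0 K0 addn_gt0 K0.
have KR : 1 <= K%:R :> R by rewrite ler1n.
have KK : 0 < K%:R :> R by lra.
have [g [w [q1 [q2 [h1 [h2 [Hh1 Hh2 e1 e2 [s1 s2 sw far av]]]]]]]] := fill k k0.
set g2 := (g * elt w)%g in e2.
have farH j h : (j <= size w)%N -> H h ->
    (K + ri)%:R <= mdist (cayley_vtx (g * elt (take j w))%g) (cayley_vtx h).
  move=> jw Hh; have [x [xh sx]] := rdist_word_ge R genT K0 KT h (g * elt (take j w))%g.
  have := av j h x jw Hh xh; rewrite -(ler_nat R) /k natrM metric_sym => h'.
  by have := le_trans h' sx; rewrite ler_pM2l.
have [p1' [pp1' Hp1' sp1']] := nearest_path g.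
have [p1 [pp1 lp1 szp1]] := lazy_path_rev pp1'.
have [q [pq Hq sq]] := nearest_path g2.
have [pm [ppm lpm spm near_]] := word_path R KS w g.
set u := last _ p1' in Hp1' pp1 lp1.
pose P := p1 ++ pm ++ q.
have pP : lazy_path u P.
  by apply/lazy_path_cat; split=> //; rewrite lp1; apply/lazy_path_cat; rewrite lpm.
pose D1 : R := (size p1)%:R; pose M : R := (size pm)%:R; pose D2 : R := (size q)%:R.
pose gam := wcurve (R := R) u P.
have LE : (size P)%:R = D1 + M + D2 :> R by rewrite /P !size_cat !natrD addrA.
have M0 : 0 <= M by exact: ler0n.
have D10 : 0 <= D1 by exact: ler0n.
have D20 : 0 <= D2 by exact: ler0n.
have lip s t : 0 <= s -> s <= t -> t <= D1 + M + D2 -> mdist (gam s) (gam t) <= t - s.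
  by move=> *; rewrite mdistE; apply: wcurve_lip => //; rewrite LE.
have gam0 : gam 0 = vtx R u by exact: wcurve0.
have gamL : gam (D1 + M + D2) = vtx R (last (g2 : V) q).
  by rewrite -LE /gam wcurve_end // /P !last_cat lp1 lpm.
have gam_mid s : 0 <= s -> s <= M -> gam (D1 + s) = wcurve (g : V) pm s.
  by move=> s0 sM; rewrite /gam /P wcurve_mid // lp1.
have gamg : gam D1 = cayley_vtx g by rewrite -[D1]addr0 gam_mid // wcurve0.
have gamg2 : gam (D1 + M) = cayley_vtx g2 by rewrite gam_mid // wcurve_end // lpm.
have D1h h : H h -> D1 <= mdist (cayley_vtx g) (cayley_vtx h) by rewrite /D1 szp1; exact: sp1'.
have D2h h : H h -> D2 <= mdist (cayley_vtx g2) (cayley_vtx h) by exact: sq.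
have rD1 : r <= D1.
  have := farH 0%N _ (leq0n _) Hp1'; rewrite take0 mulg1 natrD => h'.
  have := mdist_path_le R pp1' (erefl u); rewrite -szp1 -/D1 => h''; lra.
have rD2 : r <= D2.
  have := farH (size w) _ (leqnn _) Hq; rewrite take_size -/g2 natrD => h'.
  have := mdist_path_le R pq (erefl _); rewrite -/D2 => h''; lra.
have D1L : D1 <= D1 + M + D2 by rewrite -addrA lerDl addr_ge0.
have DML : D1 + M <= D1 + M + D2 by rewrite lerDl.
have DM0 : 0 <= D1 + M by rewrite addr_ge0.
have Lr : D1 + M + D2 - r <= D1 + M + D2 by rewrite gerBl.
have inC s : r <= s <= D1 + M + D2 - r -> co_nbhd r subgroup_vtx (gam s).
  move=> /andP[rs sL]; have s0 := le_trans r0 rs; apply: mdist_co_nbhd => _ [h Hh <-]; rewrite -/(cayley_vtx h).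
  have [sD1|sD1] := leP s D1.
    have := metric_triangle (gam D1) (gam s) (cayley_vtx h).
    rewrite {1}gamg (metric_sym (gam D1)) => tri.
    have := D1h _ Hh; have : mdist (gam s) (gam D1) <= D1 - s by exact: lip.
    lra.
  have [sM|sM] := leP (s - D1) M.
    have [||j jw jn] := near_ (s - D1); [lra|exact: sM|].
    have := farH j h jw Hh; rewrite natrD => fh.
    move: jn; rewrite -gam_mid; [|lra|exact: sM]; rewrite addrC subrK => jn.
    have := metric_triangle (cayley_vtx (g * elt (take j w))%g) (gam s) (cayley_vtx h).
    rewrite (metric_sym _ (gam s)); lra.
  have := metric_triangle (gam (D1 + M)) (gam s) (cayley_vtx h); rewrite {1}gamg2 => tri.
  have := D2h _ Hh; have : mdist (gam (D1 + M)) (gam s) <= s - (D1 + M).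
    by apply: lip => //; [rewrite -lerBrDl ltW|exact: le_trans Lr].
  lra.
have bd s h : H h -> r <= s <= D1 + M + D2 - r -> mdist (gam s) (cayley_vtx h) <= r ->
    bd_nbhd r subgroup_vtx (gam s).
  move=> Hh sr dr; rewrite /bd_nbhd /=; apply/le_anti/andP; split.
    apply: le_trans (edist_inf_le (gam s) (_ : subgroup_vtx (cayley_vtx h))) _; first by exists h.
    by rewrite lee_fin.
  by rewrite leNgt; apply/negP; exact: inC.
have rL : r <= D1 + M + D2 - r by lra.
have bd1 : bd_nbhd r subgroup_vtx (gam r).
  apply: (bd _ _ Hp1'); first by rewrite lexx rL.
  rewrite -/u -/(cayley_vtx u) metric_sym /cayley_vtx -gam0.
  by have := lip 0 r (lexx _) r0; rewrite subr0; apply; lra.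
have bd2 : bd_nbhd r subgroup_vtx (gam (D1 + M + D2 - r)).
  apply: (bd _ _ Hq); first by rewrite lexx rL.
  rewrite /cayley_vtx -gamL.
  have : mdist (gam (D1 + M + D2 - r)) (gam (D1 + M + D2)) <=
      D1 + M + D2 - (D1 + M + D2 - r) by apply: lip => //; exact: le_trans rL.
  by rewrite subKr.
have D1k : D1 <= K%:R * k%:R.
  apply: le_trans (D1h _ Hh1) _; rewrite metric_sym -e1.
  apply: le_trans (mdist_word_le R KS h1 q1) _.
  by rewrite ler_pM2l // ler_nat.
have D2k : D2 <= K%:R * k%:R.
  apply: le_trans (D2h _ Hh2) _; rewrite metric_sym -e2.
  apply: le_trans (mdist_word_le R KS h2 q2) _.
  by rewrite ler_pM2l // ler_nat.
have rk : r <= k%:R.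
  apply: (@le_trans _ _ ri%:R); first exact: ltW.
  by rewrite ler_nat /k; apply: leq_trans (leq_pmull _ K0); rewrite leq_addl.
have far12 : n%:R * r <= mdist (gam r) (gam (D1 + M + D2 - r)).
  have [x [xh sx]] := rdist_word_ge R genT K0 KT g g2.
  have xw : elt x = elt w by apply: (mulgI g).
  have := far x xw; rewrite -(ler_nat R) natrM natrM -mulrA => h'.
  have := le_trans h' sx; rewrite ler_pM2l // natrD natrM mulrDl => h''.
  have t1 := metric_triangle (cayley_vtx g) (gam r) (cayley_vtx g2).
  have t2 := metric_triangle (gam r) (gam (D1 + M + D2 - r)) (cayley_vtx g2).
  have : mdist (gam r) (gam D1) <= D1 - r by exact: lip.
  rewrite gamg metric_sym => l1.
  have : mdist (gam (D1 + M)) (gam (D1 + M + D2 - r)) <= D1 + M + D2 - r - (D1 + M).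
    by apply: lip => //; rewrite -addrA lerDl subr_ge0.
  rewrite gamg2 metric_sym => l2.
  have : n%:R * r <= n%:R * k%:R by rewrite ler_wpM2l.
  lra.
have len : (length_dist (co_nbhd r subgroup_vtx) (gam r) (gam (D1 + M + D2 - r)%R) <=
    (D1 + M + D2 - r - r)%R%:E)%E.
  apply: lip_length_dist => // s t rs st tL; apply: lip => //.
    exact: le_trans rs.
  exact: le_trans Lr.
apply: le_trans (ereal_inf_lbound _) _.
  exists (gam r), (gam (D1 + M + D2 - r)); split=> //.
  exact: le_lt_trans len (ltry _).
(* The curve avoids even the neighbourhood of radius [r], which contains that of radius
   [rho * r]. *)
apply: le_trans (length_dist_sub (C := co_nbhd r subgroup_vtx) _ _ _) _.
  move=> x xC; apply: mdist_co_nbhd => a Aa.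
  by apply: le_trans (co_nbhd_mdist xC Aa); rewrite ler_piMl.
apply: le_trans len _; rewrite lee_fin.
have MK : M <= K%:R * (C0%:R * k%:R ^+ m).
  by rewrite -natrX -!natrM ler_nat (leq_trans spm) // leq_mul2l sw orbT.
have kB : k%:R <= B%:R * r.
  rewrite /k /B !natrM -mulrA ler_pM2l // !natrD mulrDl.
  have : K%:R <= K%:R * r by rewrite ler_peMr //; lra.
  lra.
have rm : r <= r ^+ m by rewrite ler_eXnr.
have km : k%:R ^+ m <= B%:R ^+ m * r ^+ m by rewrite -exprMn lerXn2r ?nnegrE ?mulr_ge0.
have h1' : K%:R * k%:R <= K%:R * (B%:R * r ^+ m).
  by rewrite ler_pM2l // (le_trans kB) // ler_wpM2l.
have h2' : K%:R * (C0%:R * k%:R ^+ m) <= K%:R * (C0%:R * (B%:R ^+ m * r ^+ m)).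
  by rewrite ler_pM2l // ler_wpM2l.
have -> : C%:R * r ^+ m = 2 * (K%:R * (B%:R * r ^+ m)) +
    K%:R * (C0%:R * (B%:R ^+ m * r ^+ m)) + r ^+ m by rewrite CE; ring.
have : 0 <= r ^+ m by rewrite exprn_ge0.
lra.
Qed.

End Upper.

(** * Lower bound for the divergence *)

Section Lower.
Variables (R : realType) (S : finType) (adj : rel S).
Local Notation G := (racg adj).
Local Notation elt := (elt adj).
Variables (T : set G) (genT : generates T).
Local Notation V := (cayley genT).
Local Notation X := (realization R V).
Local Notation cayley_vtx := (cayley_vtx R genT).
Local Notation subgroup_vtx := (@subgroup_vtx R _ _ _ genT).
Variable H : set G.
Implicit Types (g h : G).

Variable K : nat.
Hypothesis K0 : (0 < K)%N.
Hypothesis KT : forall t, T t -> (wlen t <= K)%N.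
Hypothesis KS : forall s g, exists p, [/\ lazy_path (g : V) p,
  last (g : V) p = (g * elt [:: s])%g & (size p <= K)%N].

Lemma word_chain g (gs : seq G) :
  path (fun a b => mdist (cayley_vtx a) (cayley_vtx b) <= 3) g gs ->
  exists w, [/\ (g * elt w)%g = last g gs, (size w <= 3 * K * size gs)%N &
    forall i, exists h (y : seq S), [/\ h \in g :: gs, (size y <= 3 * K)%N &
      (h * elt y)%g = (g * elt (take i w))%g]].
Proof.
elim: gs g => [|h gs IH] g /=.
  move=> _; exists [::]; split; rewrite ?mulg1 ?muln0 // => i.
  by exists g, [::]; split; rewrite ?inE ?eqxx // take_nil.
move=> /andP[gh /IH [w [we sw nw]]].
have [x [xh sx]] := rdist_word_ge R genT K0 KT g h.
have x3 : (size x <= 3 * K)%N.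
  rewrite -(ler_nat R) natrM mulrC; apply: le_trans sx _.
  by rewrite ler_pM2l ?ltr0n.
exists (x ++ w); split.
- by rewrite elt_cat mulgA xh.
- by rewrite size_cat mulnS leq_add.
- move=> i; rewrite take_cat; case: ltnP => ix.
    exists g, (take i x); split; rewrite ?mem_head //.
    by rewrite (leq_trans _ x3) // size_take_min geq_minr.
  have [h' [y [hin sy yE]]] := nw (i - size x)%N.
  by exists h', y; rewrite in_cons hin orbT elt_cat mulgA xh.
Qed.

(** The curve is cut into steps of length at most 1 and moved to nearby vertices; these are at most
    3 apart, and words of at most [3 * K] letters between them form a path to which [filling_ge]
    applies. *)
Lemma divergence_ge m : (0 < m)%N -> filling_ge H m ->
  exists2 M : nat, (0 < M)%N & forall (rho : R) n, 0 < rho -> rho <= 1 -> (2 <= n)%N ->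
    exists c r0 : R, 0 < c /\ forall r, r0 < r ->
      ((c * r ^+ m)%:E <= divergence (subgroup_vtx H) (M * n) rho r)%E.
Proof.
move=> m0 [C fill].
(* For [r >= 1], [M * r] is at least [K * (r + 2 * (K * (r + 2) + 1) + 4) + 2 * r + 2], which is the
   demand of [QE]. *)
pose M := (4 + 7 * K + 6 * (K * K))%N.
exists M => // rho n rho0 rho1 n2.
have KR : 1 <= K%:R :> R by rewrite ler1n.
have KK : 0 < K%:R :> R by lra.
(* The power comes from the avoided word radius, about [rho * r / (2 * K)]; the denominator from
   [3 * K] letters per step and from [C], raised by 1 to be positive. *)
pose c1 : R := (rho / (2 * K%:R)) ^+ m.-1 / (3 * K%:R * (C%:R + 1)).
have C1 : 0 < C%:R + 1 :> R by have := ler0n R C; lra.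
have rK0 : 0 < rho / (2 * K%:R) by rewrite divr_gt0 // mulr_gt0.
have c10 : 0 < c1.
  by rewrite divr_gt0 ?exprn_gt0 // mulr_gt0 // mulr_gt0.
(* This is [2 * K * (1 / K + 3 * K + 1)]: once [rho * r] reaches it, [E] below exceeds half of its
   leading term by at least 1. *)
pose E0 : R := 2 + 6 * (K%:R * K%:R) + 2 * K%:R.
have K2 : 0 <= K%:R * K%:R :> R by rewrite mulr_ge0 ?ler0n.
have E00 : 0 < E0 by rewrite /E0; lra.
exists (c1 / 2), (1 + E0 / rho + 2 / c1); split; first by rewrite divr_gt0.
move=> r rr0.
have a1 : 0 < E0 / rho by rewrite divr_gt0.
have a2 : 0 < 2 / c1 by rewrite divr_gt0.
have r1 : 1 <= r by lra.
have rE : E0 <= rho * r by rewrite -ler_pdivrMl // mulrC; lra.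
have rc : 2 <= c1 * r by rewrite -ler_pdivrMl // mulrC; lra.
suff main x1 x2 c l : bd_nbhd r (subgroup_vtx H) x1 -> bd_nbhd r (subgroup_vtx H) x2 ->
    (M * n)%:R * r <= mdist x1 x2 -> curve_in (co_nbhd (rho * r) (subgroup_vtx H)) x1 x2 c ->
    (curve_length c <= l%:E)%E -> c1 / 2 * r ^+ m <= l.
  apply: le_ereal_inf_tmp => _ [x1 [x2 [[b1 b2] _ dx ->]]].
  apply: le_ereal_inf_tmp => _ [c cin <-].
  case cl: (curve_length c) => [l||].
  - by rewrite lee_fin; apply: main b1 b2 dx cin _; rewrite cl.
  - exact: leey.
  (* A length of minus infinity would be at most -1, against the positive lower bound of [main]. *)
  - have := main x1 x2 c (-1) b1 b2 dx cin; rewrite cl leNye => /(_ isT) h.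
    have h0 : 0 < c1 / 2 * r ^+ m by apply: mulr_gt0; [exact: divr_gt0|apply: exprn_gt0; lra].
    exfalso; lra.
move=> b1 b2 dx [cc c0 ce cin] cl.
have [s [ls ps as_ ss]] := curve_chain cc cl.
have [nv nvP] : exists nv : X -> G, forall x, mdist x (cayley_vtx (nv x)) <= 1.
  by have [f fP] := choice (@near_vtx R V); exists f.
have pv : path (fun a b => mdist (cayley_vtx a) (cayley_vtx b) <= 3)
    (nv (c 0)) [seq nv (c t) | t <- s].
  rewrite (@path_map _ _ (fun t => nv (c t))); apply: sub_path ps => a b ab.
  have h1 := metric_triangle (cayley_vtx (nv (c a))) (c a) (cayley_vtx (nv (c b))).
  have h2 := metric_triangle (c a) (c b) (cayley_vtx (nv (c b))).
  have h3 := nvP (c a); have h4 := nvP (c b).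
  by rewrite (metric_sym _ (c a)) in h1; move: ab => /= ab; lra.
have [w [we sw nw]] := word_chain pv.
rewrite last_map ls ce size_map in we sw.
set g := nv (c 0) in we nw pv.
have [_ [h1 Hh1 <-] d1] := bd_nbhd_near b1; have [_ [h2 Hh2 <-] d2] := bd_nbhd_near b2.
have endp x h : mdist x (cayley_vtx h) < r + 1 ->
    exists q, (h * elt q)%g = nv x /\ (size q)%:R <= K%:R * (r + 2).
  move=> xh; have [q [qe sq]] := rdist_word_ge R genT K0 KT h (nv x).
  exists q; split=> //; apply: le_trans sq _; rewrite ler_pM2l //.
  have := metric_triangle (cayley_vtx h) x (cayley_vtx (nv x)).
  rewrite (metric_sym (cayley_vtx h) x).
  have := nvP x; lra.
have [q1 [q1e s1]] := endp _ _ d1; have [q2 [q2e s2]] := endp _ _ d2.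
rewrite -c0 -/g in q1e.
pose D := (Num.trunc (K%:R * (r + 2))).+1.
have Kr0 : 0 <= K%:R * (r + 2) by rewrite mulr_ge0 //; lra.
have /andP[D1 D2] := truncn_itv Kr0; rewrite -/D in D2.
have DE : D%:R <= K%:R * (r + 2) + 1 by rewrite /D -natr1 lerD2r.
(* Lower bound for the word distance between [h1] and [h2], which are within [r + 1] of the ends of
   the curve. *)
pose Q : R := ((M * n)%:R * r - 2 * r - 2) / K%:R.
have Mn : 2 * M%:R * r <= (M * n)%:R * r.
  rewrite natrM ler_wpM2r //; first lra.
  by rewrite mulrC ler_wpM2l // ler_nat.
have ME : M%:R = 4 + 7 * K%:R + 6 * (K%:R * K%:R) :> R by rewrite /M !natrD !natrM; ring.
have QE : r + 2 * (K%:R * (r + 2) + 1) + 4 <= Q.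
  rewrite /Q ler_pdivlMr //.
  have : 2 * M%:R * r = 8 * r + 14 * (K%:R * r) + 12 * (K%:R * K%:R * r) by rewrite ME; ring.
  have : (r + 2 * (K%:R * (r + 2) + 1) + 4) * K%:R =
    K%:R * r + 2 * (K%:R * K%:R * r) + 4 * (K%:R * K%:R) + 6 * K%:R by ring.
  have : K%:R <= K%:R * r by rewrite ler_peMr //; lra.
  have : K%:R * K%:R <= K%:R * K%:R * r by rewrite ler_peMr.
  lra.
have Q0 : 0 <= Q by lra.
have /andP[Q1 Q2] := truncn_itv Q0; set n' := Num.trunc Q in Q1 Q2.
have far x : (h1 * elt x)%g = h2 -> (n' <= size x)%N.
  move=> xe; rewrite -(ler_nat R); apply: le_trans Q1 _; rewrite /Q ler_pdivrMr //.
  have := mdist_word_le R KS h1 x; rewrite xe mulrC.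
  have := metric_triangle x1 (cayley_vtx h1) x2.
  have := metric_triangle (cayley_vtx h1) (cayley_vtx h2) x2.
  rewrite (metric_sym (cayley_vtx h2)); lra.
(* The chosen vertices keep distance [rho * r - 1] from [H], and the words between them stray by at
   most [3 * K] letters. *)
pose E : R := (rho * r - 1) / K%:R - 3 * K%:R.
have EE : rho / (2 * K%:R) * r + 1 <= E.
  have -> : rho / (2 * K%:R) * r = rho * r / (2 * K%:R) by rewrite mulrAC.
  have -> : E = 2 * (rho * r / (2 * K%:R)) - 1 / K%:R - 3 * K%:R.
    by rewrite /E; field; rewrite gt_eqF.
  have : 1 / K%:R + 3 * K%:R + 1 <= rho * r / (2 * K%:R).
    rewrite ler_pdivlMr ?mulr_gt0 //; apply: le_trans rE.
    have -> : (1 / K%:R + 3 * K%:R + 1) * (2 * K%:R) = E0; last by [].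
    by rewrite /E0; field; rewrite gt_eqF.
  lra.
have E1 : 0 <= E by have := mulr_ge0 (ltW rK0) (le_trans ler01 r1); lra.
have /andP[k1 k2] := truncn_itv E1; set k := Num.trunc E in k1 k2.
have near_far h v : H h -> v \in g :: [seq nv (c t) | t <- s] ->
    rho * r - 1 <= mdist (cayley_vtx h) (cayley_vtx v).
  move=> Hh vin.
  have [t t01 ->] : exists2 t, 0 <= t <= 1 & v = nv (c t).
    move: vin; rewrite in_cons => /orP[/eqP ->|/mapP[t ts ->]].
      by exists 0; rewrite ?lexx ?ler01.
    by exists t => //; exact: (allP as_).
  have := co_nbhd_mdist (cin t t01) (_ : subgroup_vtx H (cayley_vtx h)).
  move=> /(_ (ex_intro2 _ _ h Hh erefl)).
  have := metric_triangle (c t) (cayley_vtx (nv (c t))) (cayley_vtx h).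
  rewrite (metric_sym (cayley_vtx (nv _))).
  have := nvP (c t); lra.
have av : avoids H k g w.
  move=> i h x _ Hh xe; have [v [y [vin sy ye]]] := nw i.
  have : v = (h * elt (x ++ rev y))%g by rewrite elt_cat elt_rev mulgA xe -ye mulgK.
  move=> vE; have := near_far h v Hh vin; rewrite {1}vE => nf.
  have := le_trans nf (mdist_word_le R KS h (x ++ rev y)).
  rewrite size_cat size_rev natrD => xy.
  rewrite -(ler_nat R); apply: le_trans k1 _.
  have : E <= (size x)%:R + (size y)%:R - 3 * K%:R.
    by rewrite /E lerD2r ler_pdivrMr // [leRHS]mulrC.
  have : (size y)%:R <= 3 * K%:R :> R by rewrite -natrM ler_nat.
  lra.
have szD (q : seq S) : (size q)%:R <= K%:R * (r + 2) -> (size q <= D)%N.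
  by move=> sq; rewrite -(ler_nat R) ltW // (le_lt_trans sq).
rewrite -q2e in we.
have := fill k D n' g w q1 q2 h1 h2 Hh1 Hh2 q1e (esym we) (szD _ s1) (szD _ s2) far av.
rewrite -(ler_nat R) !natrM natrX; set A := (n' - _)%N => fil.
have Ar : r <= A%:R.
  have : (n' <= A + (2 * D + 3))%N by rewrite addnC -leq_subLR.
  rewrite -(ler_nat R) !natrD natrM => nA.
  have : Q - 1 <= n'%:R by move: Q2; rewrite -natr1; lra.
  lra.
have kr : rho / (2 * K%:R) * r <= k%:R by move: k2; rewrite -natr1; lra.
have kr' : (rho / (2 * K%:R) * r) ^+ m.-1 <= k%:R ^+ m.-1.
  by rewrite lerXn2r ?nnegrE ?mulr_ge0 //; [exact: ltW|lra].
have lower : r * (rho / (2 * K%:R) * r) ^+ m.-1 <= C%:R * (size w)%:R.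
  apply: le_trans fil; apply: ler_pM => //; first lra.
  by rewrite exprn_ge0 // mulr_ge0 //; [exact: ltW|lra].
have upper : C%:R * (size w)%:R <= 3 * K%:R * (C%:R + 1) * (l + 1).
  have l1 : (size w)%:R <= 3 * K%:R * (l + 1).
    apply: (@le_trans _ _ (3 * K * size s)%:R); first by rewrite ler_nat.
    by rewrite !natrM ler_wpM2l // mulr_ge0.
  apply: (@le_trans _ _ ((C%:R + 1) * (size w)%:R)).
    by rewrite ler_wpM2r // lerDl.
  have -> : 3 * K%:R * (C%:R + 1) * (l + 1) = (C%:R + 1) * (3 * K%:R * (l + 1)) by ring.
  by rewrite ler_wpM2l // ltW.
have c1l : c1 * r ^+ m <= l + 1.
  rewrite /c1 mulrAC ler_pdivrMr ?mulr_gt0 // [leRHS]mulrC; apply: le_trans upper.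
  apply: le_trans lower; rewrite (exprMn _ (rho / (2 * K%:R)) r).
  have -> : r ^+ m = r * r ^+ m.-1 by rewrite -exprS prednK.
  by rewrite mulrCA.
have rm : r <= r ^+ m by rewrite ler_eXnr.
have : c1 * r <= c1 * r ^+ m by rewrite ler_wpM2l // ltW.
have -> : c1 / 2 * r ^+ m = c1 * r ^+ m / 2 by rewrite mulrAC.
lra.
Qed.

End Lower.

Theorem theorem1p10 (R : realType) (d : nat) (hd : (2 <= d)%N) :
  exists (S : finType) (adj : rel S),
    [/\ symmetric adj, irreflexive adj &
      forall m : nat, (2 <= m <= d)%N ->
        exists H : set (racg adj),
          [/\ is_subgroup H,
              join_free H,
              subgroup_isomorphic group_F H &
              subgroup_divergence_degree R H m]].
Proof.
exists (tree_vertex d), (@tree_adj d); split.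
- exact: tree_adj_sym.
- exact: tree_adj_irr.
move=> m hm; have m0 : (0 < m)%N by case/andP: hm => /ltnW.
pose E := @corners d m; have iE : indep (@tree_adj d) E := @corners_indep d m hm.
(* One graph serves every [m]; only the level of the corners changes. *)
exists [set g | @inspan _ (@tree_adj d) E g]; split.
- exact: inspan_subgroup.
- apply: (@inspan_join_free _ _ (@tree_adj_sym d) E
    (corner d m ord0) (corner d m ord_max) iE).
  + exact: codom_f.
  + exact: codom_f.
  + by apply/eqP => /(@corner_inj d m).
  + by move=> s t c Es Et st; exact: (@corners_common d m hm s t c).
- by apply: (inspan_isomorphic (f := corner d m) _ iE) => [|s]; [exact: corner_inj|exact: cornersP].
move=> T genT finT.
have [K [K0 KT KS]] := transfer_constant genT finT.
set H := [set g | _].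
have H1 : H 1%g by exact: inspan1.
exists ('X^m); split; first by rewrite size_polyXn.
  by move=> x x0; rewrite hornerXn exprn_ge0.
split.
  exists 1, 1%N; split=> // rho n rho0 rho1 n2; rewrite mul1r.
  have [C C0 CP] := divergence_le R H1 K0 KT KS n m0 (tree_filling_le hm).
  exists C, 1, 1, 1; split=> // x x1; rewrite hornerXn !mul1r.
  apply: le_trans (CP x rho (ltW x1) rho0 rho1) _.
  by rewrite -EFinM -EFinD lee_fin lerDl; lra.
have [M M0 MP] := divergence_ge R K0 KT KS m0 (tree_filling_ge hm).
(* The factor [M] is absorbed by the index of the family: endpoints [M * n * r] apart leave enough
   displacement along the subgroup after both ends are projected to it. *)
exists 1, M; split=> // rho n rho0 rho1 n2.
have [c [r0 [c0 cP]]] := MP rho n rho0 rho1 n2.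
exists c^-1, 1, 1, (Num.max r0 1); split; rewrite ?invr_gt0 // ?lt_max ?ltr01 ?orbT //.
move=> x; rewrite gt_max => /andP[xr x1]; rewrite hornerXn !mul1r.
have xm := cP x xr.
apply: (@le_trans _ _ (c^-1%:E * (c * x ^+ m)%:E)%E).
  by rewrite -EFinM mulKf // gt_eqF.
apply: (@le_trans _ _ (c^-1%:E * divergence (@subgroup_vtx R _ _ T genT H) (M * n) rho x)%E).
  by rewrite lee_pmul2l // ?fin_numE // lte_fin invr_gt0.
by rewrite leeDl // lee_fin; lra.
Qed.
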